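(* Let $G$ be a finite simple unmixed König graph without isolated vertices. The following are equivalent: (a) $G$ is Cohen–Macaulay; (b) $I_c(G)$ is linearly presented; (c) $\mathcal{G}_{I_c(G)}$ is connected; (d) $G$ has no duplicated vertices; (e) every induced $4$-cycle of $G$ has an edge without the (P) property; (f) $G$ has a unique perfect matching.
   Context: $G$ has vertices $t_1,\dots,t_s$, $S=K[t_1,\dots,t_s]$, $K$ a field. $G$ is unmixed if all minimal vertex covers (inclusion-minimal vertex sets meeting every edge) have the same size $\alpha_0(G)$. $G$ is König if it has a matching with $\alpha_0(G)$ edges. $G$ is Cohen–Macaulay if $S/I(G)$ is Cohen–Macaulay, where $I(G)=(t_it_j:\{t_i,t_j\}\in E(G))$. $I_c(G)$ is generated by $\prod_{t_i\in C}t_i$ over minimal vertex covers $C$; a monomial ideal minimally generated by $u_1,\dots,u_r$ is linearly presented if the $u_i$ have the same degree and the kernel of $S^r\to S$, $e_i\mapsto u_i$, is generated by vectors with linear-form entries. $\mathcal{G}_{I_c(G)}$ has the minimal vertex covers as vertices, $\{C_i,C_j\}$ ($i\ne j$) an edge iff $|C_i\cup C_j|=|C_i|+1$. Distinct vertices $t,t'$ are duplicated if $N_G(t)=N_G(t')$. An edge $e=\{t_1,t_2\}$ has the (P) property if for all edges $\{t_1,t_1'\}$, $\{t_2,t_2'\}$ distinct from $e$, $\{t_1',t_2'\}\in E(G)$. *)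

(* Defs.v *)
From mathcomp Require Import all_boot all_order all_algebra.
From mathcomp Require Import mpoly.
Set Implicit Arguments. Unset Strict Implicit. Unset Printing Implicit Defensive.
Import GRing.Theory.
Local Open Scope ring_scope.

(* Graphs: a finite simple graph on the vertex set 'I_s (vertex i     *)
(* stands for the variable t_(i+1)) is a symmetric irreflexive         *)
(* relation e : rel 'I_s.                                               *)

Section Graph.
Variable s : nat.
Variable e : rel 'I_s.

Definition simple_graph : Prop := ssrbool.symmetric e /\ irreflexive e.

Definition no_isolated_vertices : Prop := forall x, exists y, e x y.

Definition vertex_cover (C : {set 'I_s}) : bool :=
  [forall x, forall y, e x y ==> (x \in C) || (y \in C)].

Definition min_vertex_cover (C : {set 'I_s}) : bool := minset vertex_cover C.

Definition alpha0 : nat :=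
  #|[arg min_(C < setT | vertex_cover C) #|C| ]|.

Definition unmixed : Prop :=
  forall C D, min_vertex_cover C -> min_vertex_cover D -> #|C| = #|D|.

Definition is_edge (A : {set 'I_s}) : bool :=
  [exists x, exists y, e x y && (A == [set x; y])].

Definition matching (M : {set {set 'I_s}}) : bool :=
  [forall A in M, is_edge A] && trivIset M.

Definition perfect_matching (M : {set {set 'I_s}}) : bool :=
  matching M && (cover M == setT).

Definition konig : Prop := exists M, matching M /\ #|M| = alpha0.

Definition unique_perfect_matching : Prop :=
  exists M, perfect_matching M /\ forall M', perfect_matching M' -> M' = M.

Definition duplicated (t t' : 'I_s) : Prop :=
  t != t' /\ [set y | e t y] = [set y | e t' y].

Definition no_duplicated_vertices : Prop := forall t t', ~ duplicated t t'.

Definition P_property (t1 t2 : 'I_s) : Prop :=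
  forall t1' t2', e t1 t1' -> t1' != t2 -> e t2 t2' -> t2' != t1 -> e t1' t2'.

Definition induced_4cycle (a b c d : 'I_s) : Prop :=
  uniq [:: a; b; c; d] /\ e a b /\ e b c /\ e c d /\ e d a /\
  ~~ e a c /\ ~~ e b d.

Definition induced_4cycles_have_nonP_edge : Prop :=
  forall a b c d, induced_4cycle a b c d ->
    ~ P_property a b \/ ~ P_property b c \/ ~ P_property c d \/ ~ P_property d a.

Definition mincover_type := {C : {set 'I_s} | min_vertex_cover C}.

Definition cover_adj : rel mincover_type :=
  fun C D => (C != D) && (#|val C :|: val D| == #|val C|.+1).

Definition GIc_connected : Prop := forall C D : mincover_type, connect cover_adj C D.

End Graph.

Section Algebra.
Variable K : fieldType.
Variable n : nat.
Local Notation S := {mpoly K[n]}.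

Definition ideal_span (G : S -> Prop) (f : S) : Prop :=
  exists m (g c : 'I_m -> S), (forall k, G (g k)) /\ f = \sum_(k < m) c k * g k.

Definition is_ideal (P : S -> Prop) : Prop :=
  P 0 /\ (forall f g, P f -> P g -> P (f + g)) /\ (forall f g, P g -> P (f * g)).

Definition prime_ideal (P : S -> Prop) : Prop :=
  is_ideal P /\ ~ P 1 /\ (forall f g, P (f * g) -> P f \/ P g).

Definition max_ideal : S -> Prop := ideal_span (fun f => exists i, f = 'X_i).

(* Krull dimension of S/I: chains P_0 < P_1 < ... < P_d of prime ideals
   of S containing I *)
Definition prime_chain (I : S -> Prop) (d : nat) : Prop :=
  exists Ps : nat -> S -> Prop,
    (forall i, (i <= d)%N -> prime_ideal (Ps i) /\ forall f, I f -> Ps i f) /\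
    (forall i, (i < d)%N ->
       (forall f, Ps i f -> Ps i.+1 f) /\ exists f, Ps i.+1 f /\ ~ Ps i f).

Definition is_krull_dim (I : S -> Prop) (d : nat) : Prop :=
  prime_chain I d /\ forall d', prime_chain I d' -> (d' <= d)%N.

Definition regular_seq (I : S -> Prop) (fs : seq S) : Prop :=
  (forall i, (i < size fs)%N ->
     max_ideal (nth 0 fs i) /\
     let J := ideal_span (fun g => I g \/ g \in take i fs) in
     forall g, J (nth 0 fs i * g) -> J g) /\
  ~ ideal_span (fun g => I g \/ g \in fs) 1.

Definition is_depth (I : S -> Prop) (d : nat) : Prop :=
  (exists fs, size fs = d /\ regular_seq I fs) /\
  forall fs, regular_seq I fs -> (size fs <= d)%N.

Definition cohen_macaulay (I : S -> Prop) : Prop :=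
  exists d, is_depth I d /\ is_krull_dim I d.

Definition syzygy (ι : finType) (u : ι -> S) (a : ι -> S) : Prop :=
  \sum_i a i * u i = 0.

Definition linearly_presented (ι : finType) (u : ι -> S) : Prop :=
  (exists d, forall i, u i \is d.-homog) /\
  forall a, syzygy u a ->
    exists m (v : 'I_m -> ι -> S) (c : 'I_m -> S),
      (forall k, syzygy u (v k) /\ forall i, v k i \is 1.-homog) /\
      forall i, a i = \sum_(k < m) c k * v k i.

End Algebra.

Definition edge_ideal (K : fieldType) (s : nat) (e : rel 'I_s) : {mpoly K[s]} -> Prop :=
  ideal_span (fun f => exists i j, e i j /\ f = 'X_i * 'X_j).

Definition cover_monomial (K : fieldType) (s : nat) (C : {set 'I_s}) : {mpoly K[s]} :=
  \prod_(i in C) 'X_i.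

(* I_c(G) is linearly presented: applied to its minimal generators, the
   monomials of the minimal vertex covers. *)
Definition Ic_linearly_presented (K : fieldType) (s : nat) (e : rel 'I_s) : Prop :=
  linearly_presented (fun C : mincover_type e => cover_monomial K (val C)).

Arguments edge_ideal K {s} e.
Arguments Ic_linearly_presented K {s} e.

(* Main.v *)
(** An unmixed König graph without isolated vertices has a perfect matching,
    given by an involution m, and every minimal cover contains exactly one of v
    and m v. Hence every matching edge has property (P), and "m y is adjacent
    to y'" is a preorder whose symmetric part is duplication; (d), (e) and (f)
    all say that it is antisymmetric. Antisymmetry lets one move between two
    covers C and D by exchanging y for m y inside C u D, which makes all
    syzygies of I_c(G) linear; conversely linear syzygies cannot link different
    components of the graph of covers, and duplicated vertices disconnect it.

    For Cohen-Macaulayness, the pair sums t_v + t_(m v) are a regular sequence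
    on S/I(G) when the preorder is antisymmetric, by induction along
    0 -> S/(J : x) -> S/J -> S/(J, x) -> 0 with x the neighbour of a leaf.
    With g = alpha_0(G), a polynomial relation among any g + 1 elements of
    S/I(G) bounds dimension and depth by g. Conversely, a regular sequence of
    length g kills the first Koszul homology of the pair sums, while duplicated
    t, t' give the nontrivial syzygy t' (t + m t) - t (t' + m t') in I(G). *)

Require Import Defs.
From mathcomp Require Import all_boot all_order all_algebra.
From mathcomp Require Import mpoly.
From mathcomp Require Import ring zify.

Set Implicit Arguments.
Unset Strict Implicit.
Unset Printing Implicit Defensive.

Import GRing.Theory.

(** * Vertex covers, matchings, and the perfect matching of an unmixed König graph *)

Section Covers.

Variables (s : nat) (e : rel 'I_s).
Hypotheses (esym : ssrbool.symmetric e) (eirr : irreflexive e).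
Implicit Types (C D A : {set 'I_s}) (M : {set {set 'I_s}}) (m : 'I_s -> 'I_s).

Lemma vertex_coverP C :
  reflect (forall x y, e x y -> (x \in C) || (y \in C)) (vertex_cover e C).
Proof.
apply: (iffP forallP) => [H x y exy|H x].
  by have /forallP/(_ y)/implyP/(_ exy) := H x.
by apply/forallP => y; apply/implyP; apply: H.
Qed.

Lemma min_vertex_cover_cover C : min_vertex_cover e C -> vertex_cover e C.
Proof. by case/minsetP. Qed.

Lemma sub_min_vertex_cover C :
  vertex_cover e C -> exists2 D, min_vertex_cover e D & D \subset C.
Proof. by move=> HC; have [D D1 D2] := minset_exists HC; exists D. Qed.

(** The complement of an independent set is a vertex cover; shrink it to a minimal one. *)
Lemma min_vertex_cover_avoiding A :
  {in A &, forall x y, ~~ e x y} ->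
  exists2 D, min_vertex_cover e D & {in A, forall x, x \notin D}.
Proof.
move=> indA; have [|D minD /subsetP sD] := @sub_min_vertex_cover (~: A).
  apply/vertex_coverP => x y exy; rewrite !inE -negb_and.
  by apply/negP => /andP[xA yA]; have := indA _ _ xA yA; rewrite exy.
by exists D => // x xA; apply/negP => /sD; rewrite inE xA.
Qed.

Lemma min_vertex_cover_avoiding1 x :
  exists2 D, min_vertex_cover e D & x \notin D.
Proof.
have [|D mD HD] := @min_vertex_cover_avoiding [set x].
  by move=> a b /set1P-> /set1P->; rewrite eirr.
by exists D => //; apply: HD; rewrite inE.
Qed.

Lemma card_min_vertex_cover C :
  unmixed e -> min_vertex_cover e C -> #|C| = alpha0 e.
Proof.
move=> hunm mC; rewrite /alpha0; case: arg_minnP => [|C0 covC0 minC0].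
  by apply/vertex_coverP => x y; rewrite inE.
have [D mD sD] := sub_min_vertex_cover covC0.
apply/eqP; rewrite (hunm _ _ mC mD) eqn_leq subset_leq_card //=.
exact/minC0/min_vertex_cover_cover.
Qed.

Lemma matchingP M : reflect
  ((forall B, B \in M -> exists x y, e x y /\ B = [set x; y]) /\
   (forall B B' x, B \in M -> B' \in M -> x \in B -> x \in B' -> B = B'))
  (matching e M).
Proof.
apply: (iffP andP) => -[H1 H2]; split.
- move=> B BM; have /existsP[x /existsP[y /andP[exy /eqP->]]] := forall_inP H1 _ BM.
  by exists x, y.
- move=> B B' x BM B'M xB xB'.
  by rewrite -(def_pblock H2 BM xB) (def_pblock H2 B'M xB').
- apply/forall_inP => B /H1[x [y [exy ->]]].
  by apply/existsP; exists x; apply/existsP; exists y; rewrite exy /=.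
- apply/trivIsetP => B B' BM B'M; apply: contraR => /pred0Pn[x /andP[/= xB xB']].
  by apply/eqP; apply: H2 xB xB'.
Qed.

(** Every edge of [M] has an endpoint in [C], and disjoint edges give different endpoints. As [M]
    and [C] have the same size, this choice is a bijection, so [C] has no vertex outside [cover M]
    and no second vertex in an edge of [M]. *)
Lemma matching_transversal M C :
  matching e M -> vertex_cover e C -> #|C| = #|M| ->
  C \subset cover M /\ forall B x y, B \in M -> x \in B -> y \in B ->
    x \in C -> y \in C -> x = y.
Proof.
move=> /matchingP[Me Mt] /vertex_coverP covC cardC.
pose f (B : {set 'I_s}) : option 'I_s := [pick x in B :&: C].
have fP B : B \in M -> exists x, [/\ f B = Some x, x \in B & x \in C].
  move=> /Me[x [y [exy ->]]]; rewrite /f; case: pickP => [z|H].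
    by rewrite inE => /andP[zB zC]; exists z.
  have := covC _ _ exy; have := H x; have := H y; rewrite !inE !eqxx ?orbT /=.
  by move=> -> ->.
have finj : {in M &, injective f}.
  move=> B B' BM B'M; have [x [-> xB _]] := fP _ BM; have [y [-> yB' _]] := fP _ B'M.
  by case=> xy; rewrite -xy in yB'; apply: Mt xB yB'.
have /eqP fM : f @: M == Some @: C.
  rewrite eqEcard (card_in_imset finj) card_imset ?cardC ?leqnn ?andbT; last first.
    by move=> x y [].
  apply/subsetP => _ /imsetP[B BM ->]; have [x [-> _ xC]] := fP _ BM.
  exact: imset_f.
have chosen x : x \in C -> exists2 B, B \in M & f B = Some x.
  move=> xC; have : Some x \in f @: M by rewrite fM imset_f.
  by case/imsetP => B BM; exists B.
split.
  apply/subsetP => x /chosen[B BM fB]; have [x' [fB' xB _]] := fP _ BM.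
  by move: fB'; rewrite fB => -[E]; rewrite -E in xB; apply/bigcupP; exists B.
have key B x : B \in M -> x \in B -> x \in C -> f B = Some x.
  move=> BM xB /chosen[B' B'M fB']; have [x' [fB'' xB' _]] := fP _ B'M.
  have E : x = x' by move: fB''; rewrite fB' => -[].
  by rewrite -E in xB'; rewrite (Mt _ _ _ BM B'M xB xB').
move=> B x y BM xB yB xC yC; have := key _ _ BM xB xC.
by rewrite (key _ _ BM yB yC) => -[].
Qed.

Definition pairing m := involutive m /\ forall v, e v (m v).

Definition pairs m := [set [set v; m v] | v : 'I_s].

Lemma mem_pairs m v : [set v; m v] \in pairs m.
Proof. by apply/imsetP; exists v. Qed.

Lemma pairing_perfect_matching m : pairing m -> perfect_matching e (pairs m).
Proof.
move=> [mK em]; apply/andP; split; last first.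
  rewrite eqEsubset subsetT; apply/subsetP => v _; apply/bigcupP.
  by exists [set v; m v]; rewrite ?mem_pairs ?set21.
apply/matchingP; split=> [_ /imsetP[v _ ->]|_ _ x /imsetP[u _ ->] /imsetP[v _ ->]].
  by exists v, (m v).
have H w : x \in [set w; m w] -> [set w; m w] = [set x; m x].
  by move=> /set2P[->//|->]; rewrite mK setUC.
by move=> /H-> /H->.
Qed.

Lemma perfect_matching_pairing M :
  perfect_matching e M -> exists2 m, pairing m & M = pairs m.
Proof.
move=> /andP[/matchingP[Me Mt] /eqP covM].
have ex v : exists w, e v w /\ [set v; w] \in M.
  have /bigcupP[B BM vB] : v \in cover M by rewrite covM inE.
  have [x [y [exy EB]]] := Me _ BM; rewrite EB in BM vB.
  by case/set2P: vB => ->; [exists y|exists x; rewrite esym setUC].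
have [m mP] := fin_all_exists ex.
have mK : involutive m.
  move=> v; have [e1 M1] := mP v; have [e2 M2] := mP (m v).
  have /setP/(_ (m (m v))) := Mt _ _ _ M1 M2 (set22 _ _) (set21 _ _).
  rewrite set22 => /set2P[//|E]; by rewrite E eirr in e2.
exists m; first by split=> // v; case: (mP v).
apply/setP => B; apply/idP/imsetP => [BM|[v _ ->]]; last by case: (mP v).
have [x [y [exy EB]]] := Me _ BM; exists x => //.
by apply: (Mt _ _ x) => //; [case: (mP x)|rewrite EB set21|rewrite set21].
Qed.

Definition splits_min_covers m :=
  forall C v, min_vertex_cover e C -> (m v \in C) = (v \notin C).

(** The matching reaches every vertex [v]: a minimal cover avoiding a neighbour of [v] contains [v]
    and lies inside [cover M]. *)
Lemma konig_splitting_pairing :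
  no_isolated_vertices e -> unmixed e -> konig e ->
  exists2 m, pairing m & splits_min_covers m.
Proof.
move=> hno hunm [M [HM cardM]].
have tr C : min_vertex_cover e C -> _ := fun mC =>
  matching_transversal HM (min_vertex_cover_cover mC)
    (etrans (card_min_vertex_cover hunm mC) (Logic.eq_sym cardM)).
have pM : perfect_matching e M.
  rewrite /perfect_matching HM eqEsubset subsetT; apply/subsetP => v _.
  have [w evw] := hno v; have [D mD wD] := min_vertex_cover_avoiding1 w.
  have [/subsetP sD _] := tr _ mD; apply: sD.
  by have /vertex_coverP/(_ _ _ evw) := min_vertex_cover_cover mD; rewrite (negPf wD) orbF.
have [m [mK em] EM] := perfect_matching_pairing pM; exists m => // C v mC.
have /vertex_coverP/(_ _ _ (em v)) := min_vertex_cover_cover mC.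
have [_ /(_ [set v; m v] v (m v))] := tr _ mC.
rewrite EM mem_pairs set21 set22; case: (v \in C); case: (m v \in C) => //= H _.
by have := em v; rewrite -H // eirr.
Qed.

Lemma pairs_inj m m' : pairing m -> pairing m' -> pairs m = pairs m' -> m =1 m'.
Proof.
move=> [mK em] [m'K em'] E v.
have : [set v; m v] \in pairs m' by rewrite -E mem_pairs.
case/imsetP => w _ Ew.
have vw : v \in [set w; m' w] by rewrite -Ew set21.
have mvw : m v \in [set w; m' w] by rewrite -Ew set22.
have ne : m v != v by apply: contraTneq (em v) => ->; rewrite eirr.
case/set2P: mvw => E1; case/set2P: vw => E2.
- by rewrite E1 -E2 eqxx in ne.
- by rewrite E1 E2 m'K.
- by rewrite E1 E2.
- by rewrite E1 -E2 eqxx in ne.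
Qed.

End Covers.

(** * Combinatorics of the pairing: duplicates, 4-cycles, matchings, graph of covers *)

Section Pairing.

Variables (s : nat) (e : rel 'I_s).
Hypotheses (esym : ssrbool.symmetric e) (eirr : irreflexive e).
Variable m : 'I_s -> 'I_s.
Hypotheses (mK : involutive m) (em : forall v, e v (m v)).
Hypothesis msplit : splits_min_covers e m.
Implicit Types (C D A Z : {set 'I_s}).

(** If [v] were in [C] but not in a minimal cover [D] inside [C], then [m v] would lie in [D], hence
    in [C]. *)
Lemma min_vertex_cover_split C :
  vertex_cover e C -> (forall v, v \in C -> m v \notin C) ->
  min_vertex_cover e C.
Proof.
move=> covC spC; have [D mD /subsetP sD] := sub_min_vertex_cover covC.
suff -> : C = D by [].
apply/setP => v; apply/idP/idP => [vC|/sD//]; apply: contraR (spC _ vC) => vD.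
by apply: sD; rewrite msplit.
Qed.

Lemma card_min_vertex_coverC C : min_vertex_cover e C -> #|~: C| = #|C|.
Proof.
move=> mC; rewrite -(card_imset _ (inv_inj mK)); congr #|pred_of_set _|.
apply/setP => v; apply/imsetP/idP => [[w]|vC].
  by rewrite inE => wC ->; rewrite msplit.
by exists (m v); rewrite ?mK // inE msplit // negbK.
Qed.

Lemma double_card_min_vertex_cover C : min_vertex_cover e C -> #|C|.*2 = s.
Proof. by move=> /card_min_vertex_coverC H; rewrite -addnn -{2}H cardsC card_ord. Qed.

(* Property (P) for every edge {v, m v}; a minimal cover avoiding a
   non-adjacent pair {a, b} would contain both v and m v. *)
Lemma pairing_adj v a b : e v a -> e (m v) b -> e a b.
Proof.
move=> eva emb; apply/negPn/negP => nab.
have [|D mD HD] := @min_vertex_cover_avoiding _ e [set a; b].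
  by move=> x y /set2P[]-> /set2P[]->; rewrite ?eirr // esym.
have /vertex_coverP covD := min_vertex_cover_cover mD.
have := covD _ _ eva; have := covD _ _ emb.
rewrite msplit // (negPf (HD a _)) ?set21 // (negPf (HD b _)) ?set22 //.
by rewrite !orbF => /negPf->.
Qed.

(* The relation "m y is adjacent to y'" is thus a preorder y' <= y, whose
   symmetric part consists of the duplicated pairs. *)
Lemma pairing_trans y1 y2 y3 : e (m y3) y2 -> e (m y2) y1 -> e (m y3) y1.
Proof. by move=> e32 e21; apply: (@pairing_adj y2); rewrite // esym. Qed.

Lemma duplicated_pairing t t' :
  duplicated e t t' <-> [/\ t != t', e (m t) t' & e (m t') t].
Proof.
split=> [[tt' /setP N]|[tt' h h']].
  by split=> //; rewrite esym; [have := N (m t)|have := N (m t')];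
    rewrite !inE em // => <-.
split=> //; apply/setP => a; rewrite !inE; apply/idP/idP => H; rewrite esym.
  exact: pairing_adj H h.
exact: pairing_adj H h'.
Qed.

(** A chord between [t] and [t'], or between [m t] and [m t'], would give a loop by
    [pairing_adj]. *)
Lemma duplicated_induced_4cycle t t' :
  duplicated e t t' -> induced_4cycle e t (m t) t' (m t').
Proof.
move=> /duplicated_pairing[tt' h h'].
have ntt' : ~~ e t t'.
  by apply/negP => H; have := pairing_adj H h; rewrite eirr.
have nmm : ~~ e (m t) (m t').
  by apply/negP => H; have := pairing_adj (etrans (esym _ _) h') H; rewrite eirr.
do !split=> //.
rewrite /= !inE !negb_or tt' (inj_eq (inv_inj mK)) tt' (eq_sym _ t') !andbT /=.
have ne x y : e x y -> x != y by apply: contraTneq => ->; rewrite eirr.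
by rewrite !ne ?em // esym.
Qed.

Lemma P_property_duplicated t t' :
  duplicated e t t' -> P_property e t (m t').
Proof.
move=> dup; have [tt' h h'] := (duplicated_pairing t t').1 dup.
case: dup => _ /setP N a b eta _ emb _; apply: (@pairing_adj t') => //.
by have := N a; rewrite !inE => <-.
Qed.

(** In the 4-cycle of a duplicated pair two edges are matching edges and the other two join a vertex
    to the partner of its duplicate, so all four have (P). *)
Lemma no_duplicated_of_nonP_4cycles :
  induced_4cycles_have_nonP_edge e -> no_duplicated_vertices e.
Proof.
move=> H t t' dup; have dup' : duplicated e t' t.
  by case: dup => h1 h2; split; rewrite 1?eq_sym.
have Pm v : P_property e v (m v) by move=> a b h1 _ h2 _; apply: pairing_adj h1 h2.
have Psym u v : P_property e u v -> P_property e v u.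
  by move=> P a b h1 h2 h3 h4; rewrite esym; apply: P.
case: (H _ _ _ _ (duplicated_induced_4cycle dup)) => [|[|[|]]] [].
- exact: Pm.
- exact/Psym/P_property_duplicated.
- exact: Pm.
- exact/Psym/P_property_duplicated.
Qed.

Lemma P_propertyP u v : reflect (P_property e u v)
  [forall a, forall b, [&& e u a, a != v, e v b & b != u] ==> e a b].
Proof.
apply: (iffP forallP) => [H a b h1 h2 h3 h4|H a].
  by have /forallP/(_ b)/implyP := H a; rewrite h1 h2 h3 h4; apply.
by apply/forallP => b; apply/implyP => /and4P[]; apply: H.
Qed.

(** If the consecutive edges [a b] and [b c] both have (P), then [a] and [c] have the same
    neighbours. *)
Lemma nonP_4cycles_of_no_duplicated :
  no_duplicated_vertices e -> induced_4cycles_have_nonP_edge e.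
Proof.
move=> H a b c d [U [eab [ebc [ecd [eda [nac nbd]]]]]].
have [Pab|] := P_propertyP a b; last by left.
have [Pbc|] := P_propertyP b c; last by right; left.
have ac : a != c by move: U; rewrite /= !inE !negb_or => /and4P[/and3P[]].
case: (H a c); split=> //; apply/setP => x; rewrite !inE.
case: (x =P b) => [->|/eqP xb]; first by rewrite eab esym ebc.
apply/idP/idP => h; first by rewrite esym; apply: (Pab x c); rewrite // eq_sym.
by apply: (Pbc a x) => //; rewrite esym.
Qed.

Lemma no_duplicated_of_unique_matching :
  unique_perfect_matching e -> no_duplicated_vertices e.
Proof.
move=> [M [pM uM]] t t' dup; have [tt' h h'] := (duplicated_pairing t t').1 dup.
have [U _] := duplicated_induced_4cycle dup.
(* A second matching arises by exchanging partners: [m'] joins [t] to [m t'] and [t'] to [m t]. *)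
pose sw v := if v == t then t' else if v == t' then t else v.
pose m' v := if (v == t) || (v == t') then m (sw v) else sw (m v).
have pm' : pairing e m'.
  move: U; rewrite /= !inE !negb_or => /and4P[/and3P[h1 h2 h3] /andP[h4 h5] h6 _].
  split=> v; rewrite /m' /sw.
    case: (v =P t) => [->|/eqP/negPf vt] /=.
      by rewrite (eq_sym (m t')) (negPf h3) (eq_sym _ t') (negPf h6) /= mK
         (eq_sym t') (negPf tt') eqxx.
    case: (v =P t') => [->|/eqP/negPf vt'] /=.
      by rewrite (eq_sym _ t) (negPf h1) (negPf h4) /= mK eqxx.
    case: (m v =P t) => [E|/eqP/negPf vmt] /=.
      by rewrite (eq_sym t') (negPf h2) eqxx /= -E mK.
    case: (m v =P t') => [E|/eqP/negPf vmt'] /=; first by rewrite eqxx /= -E mK.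
    by rewrite vmt vmt' /= mK vt vt'.
  case: (v =P t) => [->|/eqP/negPf vt] /=; first by rewrite esym.
  case: (v =P t') => [->|/eqP/negPf vt'] /=; first by rewrite esym.
  case: (m v =P t) => [E|/eqP/negPf vmt] /=; first by rewrite -{1}(mK v) E.
  by case: (m v =P t') => [E|/eqP/negPf vmt'] //=; rewrite -{1}(mK v) E.
have E : pairs m = pairs m'.
  by rewrite (uM _ (pairing_perfect_matching _)) // (uM _ (pairing_perfect_matching _)).
have /eqP := pairs_inj eirr (conj mK em) pm' E t.
by rewrite /m' /sw eqxx /= (inj_eq (inv_inj mK)) (negPf tt').
Qed.

Section NoDuplicates.

Hypothesis nodup : no_duplicated_vertices e.

Lemma pairing_anti y y' : e (m y) y' -> e (m y') y -> y = y'.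
Proof.
move=> h h'; apply/eqP/negPn/negP => ne.
by apply: (nodup (t := y) (t' := y')); apply/duplicated_pairing.
Qed.

(** Provides a rank that is strictly monotone for the preorder, so that extremal vertices can be
    picked by [arg_min] and [arg_max]. *)
Lemma pairing_rank y y' : e (m y) y' -> y != y' ->
  #|[set w | e (m y') w]| < #|[set w | e (m y) w]|.
Proof.
move=> h ne; apply: proper_card; apply/properP; split.
  by apply/subsetP => w; rewrite !inE; apply: pairing_trans.
exists y; rewrite !inE; first by rewrite esym.
by apply: contra ne => h'; rewrite (pairing_anti h h').
Qed.

(* For a second matching m', the map y |-> m (m' y) moves weakly upwards, hence
   is the identity. *)
Lemma unique_matching_of_no_duplicated : unique_perfect_matching e.
Proof.
exists (pairs m); split=> [|M /(perfect_matching_pairing esym eirr)[m' [m'K em'] ->]].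
  exact: pairing_perfect_matching.
suff E y : m (m' y) = y by apply: eq_imset => y; rewrite (canRL mK (E y)).
apply/eqP/negPn/negP => ney.
pose d v := #|[set w | e (m v) w]|.
case: (@arg_maxnP _ y (fun v => m (m' v) != v) d) => // v nev max_v.
have /max_v : m (m' (m (m' v))) != m (m' v).
  by rewrite (inj_eq (inv_inj mK)) (inj_eq (inv_inj m'K)).
by apply/negP; rewrite -ltnNge pairing_rank // mK esym.
Qed.

(* Removing m y and adding y keeps a cover C when y is minimal in D \ C. *)
Lemma min_cover_exchange C D :
  min_vertex_cover e C -> min_vertex_cover e D -> C != D ->
  exists y, [/\ y \in D, y \notin C, m y \in C, m y \notin D &
    min_vertex_cover e (y |: (C :\ m y))].
Proof.
move=> mC mD neCD; have [y0 y0DC] : exists y, y \in D :\: C.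
  apply/set0Pn; rewrite setD_eq0; apply: contra neCD => /subsetP sDC.
  rewrite eqEsubset; apply/andP; split; apply/subsetP => // v vC.
  by apply: contraLR vC => vD; rewrite -msplit // sDC // msplit.
case: (@arg_minnP _ y0 (mem (D :\: C)) (fun v => #|[set w | e (m v) w]|) y0DC).
move=> y /=; rewrite inE => /andP[yC yD] min_y; exists y.
have myC : m y \in C by rewrite msplit.
have myD : m y \notin D by rewrite msplit // negbK.
split=> //; have covC := vertex_coverP _ _ (min_vertex_cover_cover mC).
have covD := vertex_coverP _ _ (min_vertex_cover_cover mD).
(* Only edges at the removed vertex [m y] are at risk; an uncovered one would end at an element of
   [D :\: C] strictly below [y]. *)
have my_adj w : e (m y) w -> w != y -> w \in C.
  move=> eyw ney; apply/negPn/negP => wC; have wD : w \in D.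
    by have := covD _ _ eyw; rewrite (negPf myD).
  have /min_y : w \in D :\: C by rewrite inE wC.
  by rewrite leqNgt pairing_rank // eq_sym.
apply: min_vertex_cover_split => [|v]; last first.
  have nemy : m y != y by apply: contraNneq yC => <-.
  rewrite !inE !negb_or !negb_and !negbK => /predU1P[->|/andP[nev vC]].
    by rewrite nemy eqxx.
  by rewrite (inv_eq mK) (inj_eq (inv_inj mK)) msplit // vC nev orbT.
apply/vertex_coverP => a b eab; rewrite !inE.
case: (a =P y) => //= /eqP ay; case: (b =P y) => [|/eqP] by_; rewrite ?orbT //=.
case: (a =P m y) eab => [->|/eqP amy] eab /=.
  rewrite my_adj // andbT; apply: contraTneq eab => ->; by rewrite eirr.
case: (b =P m y) eab => [->|/eqP bmy] eab /=; last exact: covC.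
by rewrite orbF my_adj // esym.
Qed.

End NoDuplicates.

(** Duplicated [t] and [t'] belong to the same minimal covers, so adjacent covers cannot differ in
    [t]. Membership of [t] is thus constant on components, although some minimal covers contain [t]
    and others avoid it. *)
Lemma no_duplicated_of_connected : GIc_connected e -> no_duplicated_vertices e.
Proof.
move=> conn t t' dup; have [tt' h h'] := (duplicated_pairing t t').1 dup.
have mem_tt' C : min_vertex_cover e C -> (t \in C) = (t' \in C).
  move=> mC; have covC := vertex_coverP _ _ (min_vertex_cover_cover mC).
  apply/idP/idP => H; apply: contraLR H => H.
    by rewrite -msplit //; have := covC _ _ h; rewrite (negPf H) orbF.
  by rewrite -msplit //; have := covC _ _ h'; rewrite (negPf H) orbF.
have adj_t : closed (@cover_adj _ e) [pred C : mincover_type e | t \in val C].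
  have half (C D : mincover_type e) : cover_adj C D -> t \in val D -> t \in val C.
    move=> /andP[_ /eqP cardCD] tD; apply/negPn/negP => tC.
    have t'D : t' \in val D by rewrite -mem_tt' ?(valP D).
    have t'C : t' \notin val C by rewrite -mem_tt' ?(valP C).
    have : #|t |: (t' |: val C)| <= #|val C :|: val D|.
      apply/subset_leq_card/subsetP => v; rewrite !inE => /or3P[/eqP->|/eqP->|->] //;
      by rewrite ?tD ?t'D ?orbT.
    by rewrite cardCD !cardsU1 !inE negb_or tt' tC t'C ltnn.
  (* Adjacency is symmetric since all minimal covers have the same size. *)
  move=> C D CD; apply/idP/idP => /=; last exact: half.
  apply: half; case/andP: CD => ne /eqP cCD; rewrite /cover_adj eq_sym ne setUC cCD /=.
  by rewrite eqSS -(inj_eq double_inj) !double_card_min_vertex_cover ?(valP C) ?(valP D).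
have [C mC tC] := min_vertex_cover_avoiding1 eirr t.
have [D mD tD] := min_vertex_cover_avoiding1 eirr (m t).
have /(closed_connect adj_t) := conn (Sub C mC) (Sub D mD).
rewrite !inE /= (negPf tC); by move: tD; rewrite msplit // negbK => ->.
Qed.

End Pairing.

(** * Ideals and regular sequences in a polynomial ring *)

Section Ideals.

Variables (K : fieldType) (n : nat).
Local Notation S := {mpoly K[n]}.
Implicit Types (I J : S -> Prop) (f g h t x : S) (fs : seq S).
Local Open Scope ring_scope.

Lemma ideal0 J : is_ideal J -> J 0.
Proof. by case. Qed.

Lemma ideal_addr J f g : is_ideal J -> J f -> J g -> J (f + g).
Proof. by case=> _ [+ _]; apply. Qed.

Lemma ideal_mull J f g : is_ideal J -> J g -> J (f * g).
Proof. by case=> _ [_]; apply. Qed.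

Lemma ideal_mulr J f g : is_ideal J -> J f -> J (f * g).
Proof. by rewrite mulrC; apply: ideal_mull. Qed.

Lemma ideal_opp J f : is_ideal J -> J f -> J (- f).
Proof. by rewrite -mulN1r; apply: ideal_mull. Qed.

Lemma ideal_sub J f g : is_ideal J -> J f -> J g -> J (f - g).
Proof. by move=> idJ Jf /(ideal_opp idJ); apply: ideal_addr. Qed.

Lemma ideal_scale J (c : K) f : is_ideal J -> J f -> J (c *: f).
Proof. by rewrite -mul_mpolyC; apply: ideal_mull. Qed.

Lemma ideal_sum J (T : eqType) (r : seq T) (F : T -> S) :
  is_ideal J -> (forall i, i \in r -> J (F i)) -> J (\sum_(i <- r) F i).
Proof.
move=> idJ HF; rewrite big_seq; elim/big_rec: _ => [|i f ri]; first exact: ideal0.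
by apply: ideal_addr => //; apply: HF.
Qed.

Lemma ideal_span_ideal (G : S -> Prop) : is_ideal (ideal_span G).
Proof.
split; first by exists 0%N, (fun _ => 0), (fun _ => 0); split=> [[]|]; rewrite ?big_ord0.
split=> [_ _ [p [g [c [Gg ->]]]] [q [g' [c' [Gg' ->]]]]|f _ [p [g [c [Gg ->]]]]].
  exists (p + q)%N, (fun k => match split k with inl i => g i | inr i => g' i end),
    (fun k => match split k with inl i => c i | inr i => c' i end); split.
    by move=> k; case: split.
  rewrite big_split_ord /=; congr (_ + _); apply: eq_bigr => i _.
    by rewrite (unsplitK (inl i)).
  by rewrite (unsplitK (inr i)).
exists p, g, (fun k => f * c k); split=> //.
by rewrite big_distrr; apply: eq_bigr => i _; rewrite /= mulrA.
Qed.

Lemma ideal_span_gen (G : S -> Prop) f : G f -> ideal_span G f.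
Proof.
move=> Gf; exists 1%N, (fun _ => f), (fun _ => 1).
by split=> //; rewrite big_ord1 mul1r.
Qed.

Lemma ideal_span_min (G : S -> Prop) J :
  is_ideal J -> (forall f, G f -> J f) -> forall f, ideal_span G f -> J f.
Proof.
move=> idJ GJ _ [p [g [c [Gg ->]]]]; apply: ideal_sum => // i _.
by apply: ideal_mull => //; apply: GJ.
Qed.

Definition ideal_add1 J t : S -> Prop := fun f => exists h, J (f - h * t).

Lemma ideal_add1_ideal J t : is_ideal J -> is_ideal (ideal_add1 J t).
Proof.
move=> idJ; split; first by exists 0; rewrite mul0r subr0; apply: ideal0.
split=> [f g [h Jf] [k Jg]|f g [h Jg]].
  exists (h + k); rewrite (_ : _ - _ = (f - h * t) + (g - k * t)); last by ring.
  exact: ideal_addr.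
exists (f * h); rewrite (_ : _ - _ = f * (g - h * t)); last by ring.
exact: ideal_mull.
Qed.

Lemma ideal_add1_sub J t f : J f -> ideal_add1 J t f.
Proof. by move=> Jf; exists 0; rewrite mul0r subr0. Qed.

Lemma ideal_add1_mem J t : is_ideal J -> ideal_add1 J t t.
Proof. by move=> idJ; exists 1; rewrite mul1r subrr; apply: ideal0. Qed.

Lemma ideal_add1_min J J' t f : is_ideal J' -> (forall g, J g -> J' g) -> J' t ->
  ideal_add1 J t f -> J' f.
Proof.
move=> idJ' sub J't [h /sub H]; rewrite -(subrK (h * t) f).
by apply: ideal_addr => //; apply: ideal_mull.
Qed.

(* [fs] is a regular sequence on S/J, except that S/(J, fs) may vanish. *)
Fixpoint wreg J fs : Prop :=
  if fs is f :: fs' then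
    (forall g, J (f * g) -> J g) /\ wreg (ideal_add1 J f) fs'
  else True.

Lemma wreg_ext J J' fs : (forall f, J f <-> J' f) -> wreg J fs -> wreg J' fs.
Proof.
elim: fs J J' => //= t fs IH J J' E [H1 H2]; split.
  by move=> g /E/H1/E.
by apply: IH H2 => f; split=> -[h /E Hh]; exists h.
Qed.

(* Multiplication by x gives the exact sequence
   0 -> S/(J : x) -> S/J -> S/(J, x) -> 0. *)
Lemma wreg_colon J x fs : is_ideal J ->
  wreg (fun f => J (f * x)) fs -> wreg (ideal_add1 J x) fs -> wreg J fs.
Proof.
elim: fs J => //= t fs IH J idJ [c1 c2] [d1 d2]; split.
  move=> g Jtg; have [h Jgh] := d1 g (ideal_add1_sub x Jtg).
  have Jhx : J (h * x).
    apply: c1; rewrite (_ : _ * x = t * g - t * (g - h * x)); last by ring.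
    by apply: ideal_sub => //; apply: ideal_mull.
  by rewrite -(subrK (h * x) g); apply: ideal_addr.
apply: IH; first exact: ideal_add1_ideal.
  apply: wreg_ext c2 => f; split=> -[h].
    by move=> H; exists (h * x); move: H; rewrite mulrBl mulrAC.
  move=> H; have [|k Jk] := d1 h.
    exists f; rewrite (_ : _ - _ = - (f * x - h * t)); last by ring.
    exact: ideal_opp.
  exists k; rewrite (_ : _ * x = (f * x - h * t) + t * (h - k * x)); last by ring.
  by apply: ideal_addr => //; apply: ideal_mull.
apply: wreg_ext d2 => f; split=> -[h [k H]]; exists k, h; move: H;
  by rewrite addrAC.
Qed.

(** With [F = f ^+ k.+2], the colon ideal [(J, F) : f] is [(J, f ^+ k.+1)] and [(J, F, f)] is
    [(J, f)], so [wreg_colon] raises the exponent by one. *)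
Lemma wreg_add1_exp J f fs k : is_ideal J -> (forall g, J (f * g) -> J g) ->
  wreg (ideal_add1 J f) fs -> wreg (ideal_add1 J (f ^+ k.+1)) fs.
Proof.
move=> idJ regf wf; elim: k => [|k IH]; first by rewrite expr1.
apply: (@wreg_colon _ f); first exact: ideal_add1_ideal.
  apply: wreg_ext IH => g; split=> -[h H]; exists h.
    rewrite (_ : _ - _ = f * (g - h * f ^+ k.+1)); first exact: ideal_mull.
    by rewrite [in LHS]exprS; ring.
  apply: regf; rewrite (_ : f * _ = g * f - h * f ^+ k.+2) //.
  by rewrite [in RHS]exprS; ring.
apply: wreg_ext wf => g; split.
  case=> h H; exists h; exact: ideal_add1_sub.
apply: ideal_add1_min (ideal_add1_ideal _ idJ) _ (ideal_add1_mem _ idJ) => h.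
apply: ideal_add1_min (ideal_add1_ideal _ idJ) _ _ => [h'|]; first exact: ideal_add1_sub.
by rewrite exprSr; apply: ideal_mull (ideal_add1_ideal _ idJ) (ideal_add1_mem _ idJ).
Qed.

(** Meant for an ideal [Q] whose radical contains [fs]: the regular sequence moves into [Q] without
    loss of length. *)
Lemma wreg_powers J fs (Q : S -> Prop) : is_ideal J -> wreg J fs ->
  (forall f, f \in fs -> exists k, Q (f ^+ k.+1)) ->
  exists fs', [/\ size fs' = size fs, wreg J fs' & forall f, f \in fs' -> Q f].
Proof.
elim: fs J => [|f fs IH] J idJ /= wJ HQ; first by exists [::].
case: wJ => regf wf; have [k Qk] := HQ f (mem_head _ _).
have [||f' ff'|fs' [sz w' Q']] := IH (ideal_add1 J (f ^+ k.+1)).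
- exact: ideal_add1_ideal.
- exact: wreg_add1_exp.
- by apply: HQ; rewrite inE ff' orbT.
exists (f ^+ k.+1 :: fs'); split; rewrite /= ?sz //; last first.
  by move=> f'; rewrite inE => /predU1P[->//|]; apply: Q'.
split=> // g; elim: {Qk w'} k => [|k IHk]; first by rewrite expr1; apply: regf.
by rewrite exprS -mulrA => /regf; apply: IHk.
Qed.

Lemma ideal_span_nil J f : is_ideal J ->
  ideal_span (fun g => J g \/ g \in [::]) f <-> J f.
Proof.
move=> idJ; split; first by apply: ideal_span_min => // g [].
by move=> Jf; apply: ideal_span_gen; left.
Qed.

Lemma ideal_span_cons J t fs f : is_ideal J ->
  ideal_span (fun g => J g \/ g \in t :: fs) f <->
  ideal_span (fun g => ideal_add1 J t g \/ g \in fs) f.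
Proof.
move=> idJ; split; apply: ideal_span_min; try exact: ideal_span_ideal.
  move=> g [Jg|]; first by apply: ideal_span_gen; left; apply: ideal_add1_sub.
  rewrite inE => /predU1P[->|gfs]; apply: ideal_span_gen; last by right.
  by left; apply: ideal_add1_mem.
move=> g [|gfs]; last by apply: ideal_span_gen; right; rewrite inE gfs orbT.
apply: ideal_add1_min; first exact: ideal_span_ideal.
  by move=> h Jh; apply: ideal_span_gen; left.
by apply: ideal_span_gen; right; apply: mem_head.
Qed.

Lemma wregP J fs : is_ideal J -> wreg J fs <->
  forall i, (i < size fs)%N -> forall g,
    ideal_span (fun h => J h \/ h \in take i fs) (nth 0 fs i * g) ->
    ideal_span (fun h => J h \/ h \in take i fs) g.
Proof.
elim: fs J => [|f fs IH] J idJ //=; split.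
  move=> [regf /(IH _ (ideal_add1_ideal f idJ)) H] [_|i ilt] g /=.
    by move=> /(ideal_span_nil _ idJ)/regf/(ideal_span_nil _ idJ).
  by move=> /(ideal_span_cons _ _ _ idJ)/(H i ilt)/(ideal_span_cons _ _ _ idJ).
move=> H; split.
  by move=> g /(ideal_span_nil _ idJ)/(H 0%N isT)/(ideal_span_nil _ idJ).
apply/IH => [|i ilt g]; first exact: ideal_add1_ideal.
by move=> /(ideal_span_cons _ _ _ idJ)/(H i.+1 ilt)/(ideal_span_cons _ _ _ idJ).
Qed.

End Ideals.

(** * Polynomial relations bound dimension and depth *)

Section Dimension.

Variables (K : fieldType) (n : nat).
Local Notation S := {mpoly K[n]}.
Implicit Types (J : nat -> S -> Prop) (f : nat -> S) (P : pred 'X_{1..n}).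
Local Open Scope ring_scope.

(** Cancelling [t ^+ a] by regularity leaves [Q a] plus a multiple of [t], and [t] lies in [I']. *)
Lemma lowest_coef_mem (I I' : S -> Prop) (t : S) (Q : nat -> S) (a D : nat) :
  is_ideal I -> is_ideal I' -> (forall g, I g -> I' g) ->
  (forall g, I (t * g) -> I g) -> I' t ->
  (a < D)%N -> (forall b, (b < a)%N -> Q b = 0) ->
  I (\sum_(b < D) t ^+ b * Q b) -> I' (Q a).
Proof.
move=> idI idI' sub regt I't; elim: a D Q => [|a IH] [|D] Q // aD Q0.
all: rewrite big_ord_recl expr0 mul1r.
all: under eq_bigr => i _ do rewrite lift0 exprS -mulrA.
all: rewrite -big_distrr /=.
  move=> /sub H; rewrite -(addrK (t * (\sum_(i < D) t ^+ i * Q i.+1)) (Q 0%N)).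
  by apply: ideal_sub => //; apply: ideal_mulr.
rewrite Q0 // add0r => /regt.
by apply: (IH D (fun b => Q b.+1)) => // b ba; apply: Q0.
Qed.

(* The j-th monomial f_0^a_0 ... f_(k-1)^a_(k-1) with all a_i < D: the a_i are
   the base D digits of j. *)
Fixpoint digit_monomial (D k : nat) f (j : nat) : S :=
  if k is k'.+1 then
    f 0%N ^+ (j %% D) * digit_monomial D k' (fun i => f i.+1) (j %/ D)
  else 1.

Lemma sum_ord_mul (p q : nat) (F : nat -> S) :
  \sum_(i < p * q) F i = \sum_(i < p) \sum_(j < q) F (i * q + j)%N.
Proof.
elim: p => [|p IH]; first by rewrite !big_ord0.
rewrite big_ord_recr /= -IH mulSn addnC big_split_ord /=.
by [].
Qed.

(* Coquand-Lombardi: dividing a polynomial relation by its lexicographically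
   lowest term makes the f_i violate regularity along the chain J. *)
Lemma relation_chain D k J f (c : nat -> K) (N : nat) :
  (0 < D)%N -> (forall i, (i <= k)%N -> is_ideal (J i)) ->
  (forall i g, (i < k)%N -> J i g -> J i.+1 g) ->
  (forall i, (i < k)%N -> J i.+1 (f i)) ->
  (forall i g, (i < k)%N -> J i (f i * g) -> J i g) ->
  (N < D ^ k)%N -> c N != 0 ->
  J 0%N (\sum_(j < D ^ k) c j *: digit_monomial D k f j) -> J k 1.
Proof.
move=> D0; elim: k J f c N => [|k IH] J f c N idJ sub mem reg ND cN.
  move: ND cN; rewrite expn0 big_ord1 ltnS leqn0 => /eqP-> /= c0 H.
  have -> : 1 = (c 0%N)^-1 *: (c 0%N *: 1) :> S by rewrite scalerA mulVf // scale1r.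
  by apply: ideal_scale; first exact: idJ.
(* The relation is sorted by powers of [f 0]: [Q b] is the coefficient of [f 0 ^+ b], and [a] below
   is the least [b] for which it is not formally zero. *)
pose Q b := \sum_(j < D ^ k) c (j * D + b)%N *: digit_monomial D k (fun i => f i.+1) j.
rewrite expnSr (sum_ord_mul _ _ (fun j => c j *: digit_monomial D k.+1 f j)).
rewrite exchange_big /=.
under eq_bigr => b _.
  under eq_bigr => j _.
    rewrite modnMDl modn_small // divnMDl // divn_small // addn0 scalerAr.
    over.
  rewrite -big_distrr /= -/(Q b); over.
have ex : exists b, (b < D)%N && [exists j : 'I_(D ^ k), c (j * D + b)%N != 0].
  exists (N %% D)%N; rewrite ltn_mod D0 /=; apply/existsP.
  have ND' : (N %/ D < D ^ k)%N by rewrite ltn_divLR // -expnSr.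
  by exists (Ordinal ND'); rewrite /= -divn_eq.
case: (ex_minnP ex) => a /andP[aD /existsP[j cj]] min_a.
move=> /(lowest_coef_mem (idJ 0%N _) (idJ 1%N _) _ _ (mem 0%N _) aD) H.
apply: (IH (fun i => J i.+1) (fun i => f i.+1) (fun j => c (j * D + a)%N) j) => //.
- by move=> i ik; apply: idJ.
- by move=> i g ik; apply: sub.
- by move=> i ik; apply: mem.
- by move=> i g ik; apply: reg.
apply: H => //; try by [move=> g; apply: sub|move=> g; apply: reg].
move=> b ba; rewrite /Q big1 // => i _.
have [->|nz] := eqVneq (c (i * D + b)%N) 0; first by rewrite scale0r.
have /min_a : (b < D)%N && [exists j : 'I_(D ^ k), c (j * D + b)%N != 0].
  by rewrite (ltn_trans ba aD); apply/existsP; exists i.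
by rewrite leqNgt ba.
Qed.

Lemma msizeM_leq (p q : S) a b :
  (msize p <= a.+1)%N -> (msize q <= b.+1)%N -> (msize (p * q) <= (a + b).+1)%N.
Proof.
have [->|p0] := eqVneq p 0; first by rewrite mul0r msize0.
have [->|q0] := eqVneq q 0; first by rewrite mulr0 msize0.
move=> hp hq; rewrite msizeM //; apply: (@leq_trans (a.+1 + b.+1).-1).
  by rewrite -!subn1 leq_sub2r // leq_add.
by rewrite addSn addnS.
Qed.

Lemma msize_digit_monomial D k f d j : (0 < D)%N ->
  (forall i, (i < k)%N -> (msize (f i) <= d.+1)%N) ->
  (msize (digit_monomial D k f j) <= (k * (D * d)).+1)%N.
Proof.
move=> D0; elim: k f j => [|k IH] f j Hf; first by rewrite /= msize1.
rewrite /= mulSn; apply: msizeM_leq; last by apply: IH => i ik; apply: Hf.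
apply: (@leq_trans (j %% D * d).+1); last first.
  by rewrite ltnS leq_mul2r ltnW ?orbT // ltn_mod.
elim: (j %% D)%N => [|a IHa]; first by rewrite expr0 msize1.
by rewrite exprS mulSn; apply: msizeM_leq => //; apply: Hf.
Qed.

Definition mon_ideal P : S -> Prop := fun p => forall u, u \in msupp p -> P u.

Definition mon_supp (u : 'X_{1..n}) : {set 'I_n} := [set i | (0 < u i)%N].

(** [w] is determined by its support and the list of its values there. For fixed [n] the bound grows
    like the [g]-th power of [E], which [D ^ g.+1] digit monomials will outgrow. *)
Lemma card_small_support (E g : nat) :
  (#|[set w : {ffun 'I_n -> 'I_E.+1} | (#|[set i | (0 < w i)%N]| <= g)%N]|
    <= 2 ^ n * E.+1 ^ g)%N.
Proof.
set W := [set w | _]; pose T (w : {ffun 'I_n -> 'I_E.+1}) := [set i | (0 < w i)%N].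
pose F w : {set 'I_n} * {ffun 'I_g -> 'I_E.+1} :=
  (T w, [ffun i : 'I_g => nth ord0 [seq w x | x <- enum (T w)] i]).
have injF : {in W &, injective F}.
  move=> w w'; rewrite !inE => cw cw' [ET /ffunP EF]; apply/ffunP => x.
  case xT: (x \in T w); last first.
    have xT' : x \in T w' = false by rewrite -ET.
    move: xT xT'; rewrite !inE !lt0n => /negbFE/eqP h /negbFE/eqP h'.
    by apply: val_inj; rewrite /= h h'.
  have lt : (index x (enum (T w)) < #|T w|)%N by rewrite cardE index_mem mem_enum.
  have := EF (Ordinal (leq_trans lt cw)); rewrite !ffunE /= -ET.
  have sz : (index x (enum (T w)) < size (enum (T w)))%N by rewrite index_mem mem_enum.
  by rewrite !(nth_map x) // nth_index ?mem_enum.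
rewrite -(card_in_imset injF); apply: leq_trans (max_card _) _.
by rewrite card_prod card_ffun !card_ord -cardsT -powersetT card_powerset cardsT card_ord.
Qed.

(* More monomials in f_0, ..., f_g with exponents below D than monomials outside
   the ideal of comparable degree, for D large. *)
Lemma relation_exists P (g : nat) f :
  (forall u, ~~ P u -> (#|mon_supp u| <= g)%N) ->
  exists D (c : nat -> K) N, [/\ (0 < D)%N, (N < D ^ g.+1)%N, c N != 0 &
    mon_ideal P (\sum_(j < D ^ g.+1) c j *: digit_monomial D g.+1 f j)].
Proof.
move=> HP; pose d := (\max_(i < g.+1) msize (f i))%N.
have Hd i : (i < g.+1)%N -> (msize (f i) <= d.+1)%N.
  move=> ig; apply: leqW.
  exact: (@leq_bigmax_cond _ xpredT (fun i : 'I_g.+1 => msize (f i)) (Ordinal ig)).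
(* [E] bounds the degrees of the digit monomials. Since [E.+1 <= D * c0] and [D] exceeds
   [2 ^ n * c0 ^ g], the set [W] has at most [2 ^ n * (D * c0) ^ g], hence fewer than [D ^ g.+1],
   elements. *)
pose c0 := (g.+1 * d).+1; pose D := (2 ^ n * c0 ^ g).+1.
pose E := (g.+1 * (D * d))%N.
have leE : (E.+1 <= D * c0)%N by rewrite /E /c0; nia.
pose W := [set w : {ffun 'I_n -> 'I_E.+1} | (#|[set i | (0 < w i)%N]| <= g)%N].
have ltW : (#|W| < D ^ g.+1)%N.
  apply: leq_ltn_trans (card_small_support _ _) _.
  apply: (@leq_ltn_trans (2 ^ n * (D * c0) ^ g)).
    have leX a b k : (a <= b)%N -> (a ^ k <= b ^ k)%N.
      by case: k => // k ab; rewrite leq_exp2r.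
    by rewrite leq_mul2l leX ?orbT.
  rewrite expnMn mulnCA expnSr ltn_mul2l expn_gt0 /=.
  by rewrite ltnS leqnn.
pose mn (w : {ffun 'I_n -> 'I_E.+1}) := [multinom (w i : nat) | i < n].
(* The columns are the monomials coded by [W], fewer than the rows; a left kernel vector gives the
   coefficients of the relation. *)
pose A : 'M[K]_(D ^ g.+1, #|W|) :=
  \matrix_(i, j) (digit_monomial D g.+1 f i)@_(mn (enum_val j)).
have /rowV0Pn[v /sub_kermxP vA v0] : kermx A != 0.
  rewrite kermx_eq0 -row_leq_rank -ltnNge; apply: leq_ltn_trans ltW.
  exact: rank_leq_col.
have [N vN] : exists N, v ord0 N != 0.
  apply/existsP; apply: contraR v0 => /existsPn H; apply/eqP/rowP => i.
  by rewrite mxE; apply/eqP; rewrite -[_ == _]negbK; apply: H.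
pose c j := oapp (v ord0) 0 (insub j : option 'I_(D ^ g.+1)).
have cE (j : 'I_(D ^ g.+1)) : c j = v ord0 j by rewrite /c valK.
exists D, c, N; split=> //; first by rewrite cE.
move=> u; rewrite mcoeff_msupp => nzu; apply/negPn/negP => nPu.
(* A monomial with an exponent above [E] has degree above [E], so it occurs in no digit monomial. *)
have ltu i : (u i < E.+1)%N.
  apply: (@leq_ltn_trans (mdeg u)); first by rewrite mdegE (bigD1 i) //= leq_addr.
  rewrite ltnNge; apply: contra nzu => leEu; rewrite raddf_sum /= big1 // => j _.
  rewrite mcoeffZ; have /msize_mdeg_ge : (msize (digit_monomial D g.+1 f j) <= mdeg u)%N.
    exact: leq_trans (msize_digit_monomial _ _ Hd) leEu.
  by rewrite -mcoeff_eq0 => /eqP->; rewrite mulr0.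
pose w : {ffun 'I_n -> 'I_E.+1} := [ffun i => inord (u i)].
have wE i : w i = u i :> nat by rewrite ffunE inordK.
have Ww : w \in W.
  rewrite inE; apply: leq_trans (HP _ nPu); apply/eq_leq/eq_card => i.
  by rewrite !inE wE.
have mnw : mn w = u by apply/mnmP => i; rewrite mnmE wE.
case/eqP: nzu; have /rowP/(_ (enum_rank_in Ww w)) := vA; rewrite !mxE => H.
rewrite raddf_sum /= -[RHS]H; apply: eq_bigr => j _.
by rewrite mcoeffZ cE mxE enum_rankK_in // mnw.
Qed.

(** Serves both bounds: [J] will be a chain of primes with [f i] in [J i.+1] but not in [J i], or
    the ideals of initial segments of a regular sequence. *)
Lemma regular_chain_bound P (g : nat) J f :
  (forall u, ~~ P u -> (#|mon_supp u| <= g)%N) ->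
  (forall i, (i <= g.+1)%N -> is_ideal (J i)) ->
  (forall p, mon_ideal P p -> J 0%N p) ->
  (forall i p, (i < g.+1)%N -> J i p -> J i.+1 p) ->
  (forall i, (i < g.+1)%N -> J i.+1 (f i)) ->
  (forall i p, (i < g.+1)%N -> J i (f i * p) -> J i p) ->
  J g.+1 1.
Proof.
move=> HP idJ sub0 sub mem reg.
have [D [c [N [D0 ND cN /sub0 rel]]]] := relation_exists f HP.
exact: relation_chain D0 idJ sub mem reg ND cN rel.
Qed.

End Dimension.

(** * Monomial ideals and primes generated by variables *)

Section MonomialIdeals.

Variables (K : fieldType) (n : nat).
Local Notation S := {mpoly K[n]}.
Implicit Types (P : pred 'X_{1..n}) (p : S) (u v : 'X_{1..n}) (W : {set 'I_n}).
Local Open Scope ring_scope.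

Lemma mon_ideal_ideal P :
  (forall u v, P u -> P (u + v)%MM) -> is_ideal (@mon_ideal K n P).
Proof.
move=> Pup; split; first by move=> u; rewrite msupp0.
split=> [p q Hp Hq u /msuppD_le|p q Hq u /msuppM_le/allpairsP[[a b] /= [_ /Hq Pb ->]]].
  by rewrite mem_cat => /orP[/Hp|/Hq].
by rewrite addmC; apply: Pup.
Qed.

Lemma mon_ideal_min P (J : S -> Prop) : is_ideal J ->
  (forall u, P u -> J 'X_[u]) -> forall p, mon_ideal P p -> J p.
Proof.
move=> idJ PJ p Hp; rewrite (mpolyE p); apply: ideal_sum => // u /Hp/PJ.
exact: ideal_scale.
Qed.

Lemma mon_idealX P u : mon_ideal P ('X_[u] : S) <-> P u.
Proof.
split=> [|Pu v]; first by apply; rewrite msuppX mem_seq1.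
by rewrite msuppX mem_seq1 => /eqP->.
Qed.

Lemma mon_ideal_mulX P p u :
  mon_ideal P (p * 'X_[u]) <-> mon_ideal (fun v => P (u + v)%MM) p.
Proof.
split=> H v; last by rewrite (perm_mem (msuppMX _ _)) => /mapP[w /H Pw ->].
by move=> vp; apply: H; rewrite (perm_mem (msuppMX _ _)) map_f.
Qed.

Lemma ideal_add1_congr (J : S -> Prop) (t t' : S) p : is_ideal J -> J (t - t') ->
  ideal_add1 J t p <-> ideal_add1 J t' p.
Proof.
move=> idJ Jtt'; split=> -[h Jh]; exists h.
  rewrite (_ : _ - _ = (p - h * t) + h * (t - t')); last by ring.
  by apply: ideal_addr => //; apply: ideal_mull.
rewrite (_ : _ - _ = (p - h * t') - h * (t - t')); last by ring.
by apply: ideal_sub => //; apply: ideal_mull.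
Qed.

(** A substitution whose kernel is the ideal generated by the variables of [W]; as a kernel into a
    domain it is visibly prime. *)
Definition kill W : n.-tuple S := [tuple if i \in W then 0 else 'X_i | i < n].

Lemma kill_prime W : prime_ideal (fun p => p \mPo kill W = 0).
Proof.
split; last split.
- split; first exact: comp_mpoly0.
  split=> [p q|p q]; first by rewrite comp_mpolyD => -> ->; rewrite addr0.
  by rewrite rmorphM /= => ->; rewrite mulr0.
- by rewrite comp_mpoly1; apply/eqP; rewrite oner_eq0.
- by move=> p q /eqP; rewrite rmorphM /= mulf_eq0 => /orP[]/eqP->; [left|right].
Qed.

Lemma killX W i : 'X_i \mPo kill W = if i \in W then 0 else 'X_i.
Proof. by rewrite comp_mpolyXU -tnth_nth tnth_mktuple. Qed.

Lemma kill_comp W W' p : W \subset W' -> p \mPo kill W' = (p \mPo kill W) \mPo kill W'.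
Proof.
move=> sWW'; rewrite (comp_mpolyEX p (kill W)) (comp_mpolyEX p) raddf_sum /=.
apply: eq_bigr => u _; rewrite comp_mpolyZ; congr (_ *: _).
rewrite !comp_mpolyX rmorph_prod /=; apply: eq_bigr => i _.
rewrite rmorphXn /= !tnth_mktuple; congr (_ ^+ _); case: ifP => iW'.
  by case: ifP => iW; rewrite ?comp_mpoly0 // killX iW'.
by case: ifP => [/(subsetP sWW')|_]; rewrite ?iW' // killX iW'.
Qed.

End MonomialIdeals.

(** * Edge ideals enlarged by variables *)

Section EdgeIdeals.

Variables (K : fieldType) (s : nat) (e : rel 'I_s).
Hypotheses (esym : ssrbool.symmetric e) (eirr : irreflexive e).
Local Notation S := {mpoly K[s]}.
Implicit Types (p : S) (u v : 'X_{1..s}) (Z C W : {set 'I_s}).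
Local Open Scope ring_scope.

(* The monomials of the ideal I(G) + (t_z : z in Z). *)
Definition edge_mon Z u : bool :=
  [exists z in Z, (0 < u z)%N] ||
  [exists a, exists b, [&& e a b, (0 < u a)%N & (0 < u b)%N]].

Lemma edge_monP Z u : reflect
  ((exists2 z, z \in Z & (0 < u z)%N) \/
   exists a b, [/\ e a b, (0 < u a)%N & (0 < u b)%N])
  (edge_mon Z u).
Proof.
apply: (iffP orP) => -[].
- by case/exists_inP => z; left; exists z.
- by case/existsP => a /existsP[b /and3P[h1 h2 h3]]; right; exists a, b.
- by case=> z h1 h2; left; apply/exists_inP; exists z.
case=> a [b [h1 h2 h3]]; right.
by apply/existsP; exists a; apply/existsP; exists b; apply/and3P.
Qed.

Lemma edge_mon_ideal Z : is_ideal (@mon_ideal K s (edge_mon Z)).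
Proof.
apply: mon_ideal_ideal => u v /edge_monP H; apply/edge_monP.
case: H => [[z zZ uz]|[a [b [eab ua ub]]]]; [left; exists z|right; exists a, b] => //.
  by rewrite mnmDE ltn_addr.
by rewrite !mnmDE !ltn_addr.
Qed.

Lemma edge_idealE p : edge_ideal K e p <-> mon_ideal (edge_mon set0) p.
Proof.
split.
  apply: ideal_span_min (edge_mon_ideal _) _ p => _ [i [j [eij ->]]].
  rewrite -mpolyXD; apply/mon_idealX/edge_monP; right; exists i, j.
  by split; rewrite // mnmDE !mnm1E eqxx ?addn1 ?add1n.
apply: mon_ideal_min; first exact: ideal_span_ideal.
move=> u /edge_monP[[z]|[a [b [eab ua ub]]]]; first by rewrite inE.
have le : (U_(a) + U_(b) <= u)%MM.
  apply/mnm_lepP => i; rewrite mnmDE !mnm1E.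
  case: (a =P i) => [<-|_]; last by case: (b =P i) => [<-|].
  by case: (b =P a) eab => [->|_ _]; rewrite ?eirr.
rewrite -(submK le) mpolyXD; apply: ideal_mull; first exact: ideal_span_ideal.
by apply: ideal_span_gen; exists a, b; rewrite mpolyXD.
Qed.

(** A monomial outside the ideal enters it on multiplication by ['X_x] only through an edge at [x],
    whose other end must divide it. *)
Lemma edge_mon_colon Z x p : x \notin Z ->
  mon_ideal (edge_mon Z) (p * 'X_x) <->
  mon_ideal (edge_mon (Z :|: [set y | e x y])) p.
Proof.
move=> xZ; rewrite mon_ideal_mulX.
suff E u : edge_mon Z (U_(x) + u)%MM = edge_mon (Z :|: [set y | e x y]) u.
  by split=> H u /H; rewrite E.
apply/edge_monP/edge_monP => -[].
- case=> z zZ; rewrite mnmDE mnm1E; case: (x =P z) => [E|_ uz].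
    by rewrite E zZ in xZ.
  by left; exists z; rewrite // inE zZ.
- case=> a [b [eab]]; rewrite !mnmDE !mnm1E.
  case: (x =P a) => [Ea _|_]; case: (x =P b) => [Eb|_].
  + by rewrite -Ea -Eb eirr in eab.
  + by move=> ub; left; exists b; rewrite // !inE Ea eab orbT.
  + by move=> ua _; left; exists a; rewrite // !inE Eb esym eab orbT.
  + by move=> ua ub; right; exists a, b.
- case=> z; rewrite !inE => /orP[zZ|exz] uz.
    by left; exists z; rewrite // mnmDE ltn_addl.
  by right; exists x, z; split; rewrite // mnmDE ?mnm1E ?eqxx // ltn_addl.
- by case=> a [b [eab ua ub]]; right; exists a, b; split; rewrite // mnmDE ltn_addl.
Qed.

Lemma edge_mon_add1 Z x p :
  ideal_add1 (mon_ideal (edge_mon Z)) 'X_x p <->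
  mon_ideal (edge_mon (x |: Z)) p.
Proof.
have idZ := edge_mon_ideal Z; split.
  apply: ideal_add1_min (edge_mon_ideal _) _ _ => [q Hq u /Hq/edge_monP H|].
    apply/edge_monP; case: H => [[z zZ uz]|]; last by right.
    by left; exists z; rewrite // !inE zZ orbT.
  by apply/mon_idealX/edge_monP; left; exists x; rewrite ?setU11 // mnm1E eqxx.
apply: mon_ideal_min (ideal_add1_ideal _ idZ) _ p => u /edge_monP[[z]|H]; last first.
  by apply/ideal_add1_sub/mon_idealX/edge_monP; right.
rewrite !inE => /predU1P[->|zZ] uz; last first.
  by apply/ideal_add1_sub/mon_idealX/edge_monP; left; exists z.
have le : (U_(x) <= u)%MM.
  by apply/mnm_lepP => i; rewrite mnm1E; case: (x =P i) => [<-|].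
rewrite -(submK le) mpolyXD.
exact: ideal_mull (ideal_add1_ideal _ idZ) (ideal_add1_mem _ idZ).
Qed.

(** The variables of [C] generate a prime containing the edge ideal; the vertices outside [C] are
    adjoined one at a time. *)
Lemma cover_prime_chain C : vertex_cover e C -> prime_chain (edge_ideal K e) #|~: C|.
Proof.
move=> /vertex_coverP covC; pose r := enum (~: C).
pose W i := C :|: [set v in take i r].
exists (fun i p => p \mPo kill K (W i) = 0); split=> [i _|i].
  split; first exact: kill_prime.
  apply: ideal_span_min; first by case: (kill_prime K (W i)).
  move=> _ [a [b [/covC H ->]]]; rewrite rmorphM /= !killX !inE.
  by case/orP: H => ->; rewrite ?mul0r ?mulr0.
rewrite cardE -/r => ilt; have x0 : 'I_s by case: (r) ilt => [//|x _ _]; exact: x.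
have Wi : W i \subset W i.+1.
  apply: setUS; apply/subsetP => v; rewrite !inE.
  by rewrite (take_nth x0) // mem_rcons inE orbC => ->.
split; first by move=> p Hp; rewrite (kill_comp _ Wi) Hp comp_mpoly0.
exists 'X_(nth x0 r i); rewrite !killX !inE.
rewrite (take_nth x0) // mem_rcons inE eqxx orbT; split=> //.
have : nth x0 r i \in ~: C by rewrite -mem_enum mem_nth.
rewrite inE => /negPf->; rewrite in_take ?mem_nth // index_uniq ?enum_uniq // ltnn /=.
by move/eqP; rewrite -msize_poly_eq0 msizeX.
Qed.

End EdgeIdeals.

(** * Dimension of the edge ring and regularity of the pair sums *)

Section Depth.

Variables (K : fieldType) (s : nat) (e : rel 'I_s).
Hypotheses (esym : ssrbool.symmetric e) (eirr : irreflexive e).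
Variable m : 'I_s -> 'I_s.
Hypotheses (mK : involutive m) (em : forall v, e v (m v)).
Hypothesis msplit : splits_min_covers e m.
Variable C : {set 'I_s}.
Hypothesis mC : min_vertex_cover e C.
Local Notation S := {mpoly K[s]}.
Implicit Types (W Z : {set 'I_s}).
Local Open Scope ring_scope.

(** The support of a monomial outside the edge ideal is independent, so it avoids some minimal
    cover, and all minimal covers have complements of the same size. *)
Lemma card_mon_supp u : ~~ edge_mon e set0 u -> (#|mon_supp u| <= #|~: C|)%N.
Proof.
move=> /edge_monP nu; have [|D mD HD] := @min_vertex_cover_avoiding _ e (mon_supp u).
  move=> a b; rewrite !inE => ua ub; apply/negP => eab; apply: nu.
  by right; exists a, b.
have -> : #|~: C| = #|~: D|.
  rewrite !(card_min_vertex_coverC mK msplit) //; apply: double_inj.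
  by rewrite !(double_card_min_vertex_cover mK msplit).
by apply/subset_leq_card/subsetP => v /HD; rewrite inE.
Qed.

Lemma krull_dim_edge_ideal : is_krull_dim (edge_ideal K e) #|~: C|.
Proof.
split; first exact/cover_prime_chain/min_vertex_cover_cover.
move=> d [Ps [primePs chainPs]]; rewrite leqNgt; apply/negP => ltd.
(* An element of [Ps i.+1] outside [Ps i] is regular modulo the prime [Ps i]. *)
have [f Hf] := fin_all_exists (fun i : 'I_(#|~: C|.+1) =>
  (chainPs i (leq_trans (ltn_ord i) ltd)).2).
pose f' i := oapp f 0 (insub i : option 'I_(#|~: C|.+1)).
have Hf' i : (i < #|~: C|.+1)%N -> Ps i.+1 (f' i) /\ ~ Ps i (f' i).
  by move=> il; rewrite /f' insubT; apply: (Hf (Ordinal il)).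
have [[_ [no1 _]] _] := primePs _ ltd; apply: no1.
apply: (@regular_chain_bound K s (edge_mon e set0) _ Ps f') => //.
- exact: card_mon_supp.
- by move=> i il; case: (primePs i (leq_trans il ltd)) => -[].
- by move=> p /(edge_idealE eirr); apply: (primePs 0%N _).2.
- by move=> i p il; apply: (chainPs i (leq_trans il ltd)).1.
- by move=> i /Hf'[].
- move=> i p il; have [[_ [_ prime]] _] := primePs i (ltnW (leq_trans il ltd)).
  by case/prime => // /(Hf' i il).2.
Qed.

Lemma regular_seq_size fs : regular_seq (edge_ideal K e) fs -> (size fs <= #|~: C|)%N.
Proof.
move=> [reg no1]; rewrite leqNgt; apply/negP => ltf; apply: no1.
pose J i := ideal_span (fun g => edge_ideal K e g \/ g \in take i fs).
suff : J #|~: C|.+1 1.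
  apply: ideal_span_min; first exact: ideal_span_ideal.
  by move=> g [?|/mem_take ?]; apply: ideal_span_gen; [left|right].
apply: (@regular_chain_bound K s (edge_mon e set0) _ J (nth 0 fs)) => //.
- exact: card_mon_supp.
- by move=> i _; apply: ideal_span_ideal.
- by move=> p /(edge_idealE eirr) Ip; apply: ideal_span_gen; left.
- move=> i p il; apply: ideal_span_min; first exact: ideal_span_ideal.
  move=> g [Ig|gt]; apply: ideal_span_gen; [by left|right].
  by rewrite (take_nth 0 (leq_trans il ltf)) mem_rcons inE gt orbT.
- move=> i il; apply: ideal_span_gen; right.
  by rewrite (take_nth 0 (leq_trans il ltf)) mem_rcons mem_head.
- by move=> i p il; apply: (reg i (leq_trans il ltf)).2.
Qed.

Definition pair_sum v : S := 'X_v + 'X_(m v).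

(** When [W] is a cover, its variables absorb the edge ideal, and modulo them each pair sum is a
    single variable outside [W]. *)
Lemma wreg_cover W ys : vertex_cover e W -> uniq ys -> {subset ys <= ~: C} ->
  {in ys, forall y, (m y \in W) = (y \notin W)} ->
  wreg (mon_ideal (edge_mon e W)) [seq pair_sum y | y <- ys].
Proof.
elim: ys W => //= y ys IH W covW /andP[yys uys] sub spl.
have cov := vertex_coverP _ _ covW; have idW := edge_mon_ideal K e W.
have memX x : x \in W -> mon_ideal (edge_mon e W) ('X_x : S).
  by move=> xW; apply/mon_idealX/edge_monP; left; exists x; rewrite // mnm1E eqxx.
have colW x g : x \notin W -> mon_ideal (edge_mon e W) (g * 'X_x : S) ->
    mon_ideal (edge_mon e W) g.
  move=> xW /(edge_mon_colon esym eirr _ xW).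
  suff /setUidPl-> : [set b | e x b] \subset W by [].
  by apply/subsetP => b; rewrite inE => /cov; rewrite (negPf xW).
have [x [z [E xW zW yxz]]] : exists x z, [/\ pair_sum y = 'X_x + 'X_z, x \in W,
    z \notin W & z = y \/ z = m y].
  have := spl y (mem_head _ _); case yW: (y \in W) => /= myW.
    by exists y, (m y); rewrite yW myW; split=> //; right.
  by exists (m y), y; rewrite yW myW; split=> //; [apply: addrC|left].
rewrite E; split.
  move=> g; rewrite mulrDl => H; apply: (colW z) => //.
  rewrite -(addKr ('X_x * g) (g * 'X_z)) addrC (mulrC g) addrC.
  apply: (ideal_addr idW) => //; apply: (ideal_opp idW).
  by apply: (ideal_mulr _ idW); apply: memX.
apply: (@wreg_ext _ _ (mon_ideal (edge_mon e (z |: W)))).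
  move=> p; rewrite (ideal_add1_congr p idW (t' := 'X_z)) ?addrK; last exact: memX.
  by rewrite edge_mon_add1.
apply: IH => //.
- by apply/vertex_coverP => a b /cov; rewrite !inE => /orP[]->; rewrite !orbT.
- by move=> v vys; apply: sub; rewrite inE vys orbT.
move=> v vys; rewrite !inE negb_or -spl ?inE ?vys ?orbT //.
have neC a b : a \in y :: ys -> b \in y :: ys -> m a != b.
  move=> /sub + /sub; rewrite !inE -(msplit a mC) => h1 h2.
  by apply: contraNneq h2 => <-.
have vy : v != y by apply: contraNneq yys => <-.
have vmem : v \in y :: ys by rewrite inE vys orbT.
case: yxz => ->; first by rewrite (negPf (neC v y _ _)) ?mem_head // vy.
rewrite (inj_eq (inv_inj mK)) (negPf vy) /=.
by rewrite eq_sym (negPf (neC y v _ _)) ?mem_head.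
Qed.

Hypothesis nodup : no_duplicated_vertices e.

(** [Z] is a down-set of the preorder with at most one vertex of each pair. If [Z] meets every pair,
    it is a cover. Otherwise, among the pairs outside [Z], a [y] of largest rank has no neighbour
    outside [Z] but [m y]; [wreg_colon] for [m y] enlarges [Z] by the neighbours of [m y],
    respectively by [m y], and both sets are again of this kind. *)
Lemma wreg_pair_sums Z ys :
  uniq ys -> {subset ys <= ~: C} ->
  (forall z, z \in Z -> m z \notin Z) ->
  (forall z w, z \in Z -> e (m z) w -> w \in Z) ->
  wreg (mon_ideal (edge_mon e Z)) [seq pair_sum y | y <- ys].
Proof.
move=> uys sub; have [k] := ubnP #|~: Z|; elim: k Z => // k IH Z.
rewrite ltnS => leZ disjZ closedZ.
have [v0 /= rem0|all] := pickP [pred v | (v \notin Z) && (m v \notin Z)]; last first.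
  have spl v : (m v \in Z) = (v \notin Z).
    have /negbT := all v; rewrite /= negb_and !negbK.
    case vZ: (v \in Z) => /=; last by move->.
    by move=> _; apply/negbTE/disjZ.
  apply: wreg_cover => //; apply/vertex_coverP => a b eab.
  case aZ: (a \in Z) => //=; apply: (closedZ (m a)); first by rewrite spl aZ.
  by rewrite mK.
case: (@arg_maxnP _ v0 (fun v => (v \notin Z) && (m v \notin Z))
  (fun v => #|[set w | e (m v) w]|) rem0) => y /andP[yZ xZ] max_y.
have leaf w : e y w -> w \in m y |: Z.
  move=> eyw; rewrite !inE; have [//|ne /=] := eqVneq w (m y).
  apply/negPn/negP => wZ; have mwZ : m w \notin Z.
    by apply: contra yZ => mwZ; apply: (closedZ (m w)); rewrite // mK esym.
  have /max_y : (m w \notin Z) && (m (m w) \notin Z) by rewrite mwZ mK wZ.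
  apply/negP; rewrite -ltnNge (pairing_rank esym eirr em msplit nodup) ?mK //.
    by rewrite esym.
  by rewrite (inv_eq mK).
have closed_nbr z w : e (m y) z -> e (m z) w -> e (m y) w.
  by move=> exz ezw; apply: (pairing_adj esym eirr msplit (v := z)); rewrite // esym.
apply: (@wreg_colon _ _ _ 'X_(m y)); first exact: edge_mon_ideal.
  apply: (@wreg_ext _ _ (mon_ideal (edge_mon e (Z :|: [set w | e (m y) w])))).
    by move=> p; rewrite edge_mon_colon.
  apply: IH => [|z|z w].
  - apply: leq_trans leZ; apply: proper_card; rewrite setCU.
    apply/properP; split; first exact: subsetIl.
    by exists y; rewrite !inE // esym em andbF.
  - rewrite !inE negb_or => /orP[zZ|exz].
      rewrite disjZ //=; apply: contra xZ => exmz; apply: (closedZ z) => //.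
      by rewrite esym.
    apply/andP; split.
      by apply: contra xZ => mzZ; apply: (closedZ (m z)); rewrite // mK esym.
    apply/negP => exmz; have := closed_nbr z (m y) exz.
    by rewrite (esym (m z)) exmz eirr => /(_ isT).
  - rewrite !inE => /orP[zZ /(closedZ _ _ zZ)->//|exz ezw].
    by rewrite (closed_nbr z) ?orbT.
apply: (@wreg_ext _ _ (mon_ideal (edge_mon e (m y |: Z)))).
  by move=> p; rewrite edge_mon_add1.
apply: IH => [|z|z w].
- apply: leq_trans leZ; apply: proper_card; apply/properP; split.
    by apply/subsetP => v; rewrite !inE negb_or => /andP[].
  by exists (m y); rewrite !inE ?eqxx.
- rewrite !inE negb_or => /predU1P[->|zZ].
    by rewrite mK yZ andbT; apply: contraTneq (em y) => <-; rewrite eirr.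
  by rewrite disjZ // andbT (inj_eq (inv_inj mK)); apply: contraNneq yZ => <-.
- rewrite in_setU1 => /predU1P[->|zZ]; first by rewrite mK; apply: leaf.
  by move=> /(closedZ _ _ zZ) wZ; rewrite !inE wZ orbT.
Qed.

Lemma cohen_macaulay_of_no_duplicated : cohen_macaulay (edge_ideal K e).
Proof.
exists #|~: C|; split; last exact: krull_dim_edge_ideal.
split; last exact: regular_seq_size.
pose fs := [seq pair_sum y | y <- enum (~: C)].
exists fs; split; first by rewrite size_map -cardE.
have maxX v : max_ideal ('X_v : S) by apply: ideal_span_gen; exists v.
split=> [i ilt|].
  split.
    have /mapP[y _ ->] := mem_nth 0 ilt.
    exact: ideal_addr (ideal_span_ideal _) (maxX y) (maxX (m y)).
  move: i ilt; apply/wregP; first exact: ideal_span_ideal.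
  apply: (@wreg_ext _ _ (mon_ideal (edge_mon e set0))).
    by move=> p; rewrite edge_idealE.
  apply: wreg_pair_sums; first exact: enum_uniq.
  - by move=> v; rewrite mem_enum.
  - by move=> z; rewrite inE.
  - by move=> z w; rewrite inE.
(* All generators have zero constant term, so they do not generate 1. *)
have idQ : is_ideal (@mon_ideal K s (fun u => u != 0%MM)).
  by apply: mon_ideal_ideal => u v; rewrite mnmD_eq0 negb_and => ->.
have QX v : mon_ideal (fun u => u != 0%MM) ('X_v : S).
  by apply/mon_idealX; rewrite mnm1_eq0.
suff H p : ideal_span (fun g => edge_ideal K e g \/ g \in fs) p ->
    mon_ideal (fun u => u != 0%MM) p.
  by move=> /H/(_ 0%MM); rewrite msupp1 mem_seq1 eqxx => /(_ isT).
apply: ideal_span_min => // g [|/mapP[y _ ->]]; last exact: (ideal_addr idQ).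
by apply: (ideal_span_min idQ) => _ [a [b [_ ->]]]; apply: (ideal_mull _ idQ).
Qed.

End Depth.

(** * The Koszul complex and its exactness *)

Section Koszul.

Variables (K : fieldType) (n : nat).
Local Notation S := {mpoly K[n]}.
Implicit Types (J Q : S -> Prop) (t c : nat -> S) (z y : seq bool -> S).
Local Open Scope ring_scope.

(* Koszul chains on t_0, ..., t_(k-1) assign a coefficient to each word of k
   bits, the word being the indicator of a subset of the indices. *)
Fixpoint koszul t z (w : seq bool) : S :=
  match w with
  | [::] => 0
  | b :: w' =>
    let d := koszul (fun i => t i.+1) (fun v => z (b :: v)) w' in
    if b then - d else d + t 0%N * z (true :: w')
  end.

(** Exterior multiplication by the 1-chain with coefficients [c i]. *)
Fixpoint koszul_wedge c z (w : seq bool) : S :=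
  match w with
  | [::] => 0
  | b :: w' =>
    let h := koszul_wedge (fun i => c i.+1) (fun v => z (b :: v)) w' in
    if b then c 0%N * z (false :: w') - h else h
  end.

Lemma eq_koszul t z y w : z =1 y -> koszul t z w = koszul t y w.
Proof.
elim: w t z y => //= b w IH t z y E; have := IH (fun i => t i.+1) _ _ (fun v => E (b :: v)).
by case: b => ->; rewrite // E.
Qed.

Lemma eq_koszul_wedge c z y w : z =1 y -> koszul_wedge c z w = koszul_wedge c y w.
Proof.
elim: w c z y => //= b w IH c z y E; have := IH (fun i => c i.+1) _ _ (fun v => E (b :: v)).
by case: b => ->; rewrite // E.
Qed.

Lemma koszul_linear t a b z y w :
  koszul t (fun v => a * z v + b * y v) w = a * koszul t z w + b * koszul t y w.
Proof.
elim: w t z y => [|[] w IH] t z y /=; first by rewrite !mulr0 addr0.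
  by rewrite IH; ring.
by rewrite IH; ring.
Qed.

Lemma koszul_wedge_linear c a b z y w :
  koszul_wedge c (fun v => a * z v + b * y v) w =
  a * koszul_wedge c z w + b * koszul_wedge c y w.
Proof.
elim: w c z y => [|[] w IH] c z y /=; first by rewrite !mulr0 addr0.
  by rewrite IH; ring.
by rewrite IH.
Qed.

Lemma koszul_koszul t z w : koszul t (koszul t z) w = 0.
Proof.
elim: w t z => [|[] w IH] t z //=.
  rewrite (@eq_koszul _ _ (fun v => (-1) * koszul (fun i => t i.+1)
    (fun v => z (true :: v)) v + 0 * z v)) => [|v]; last by ring.
  by rewrite koszul_linear IH; ring.
rewrite (@eq_koszul _ _ (fun v => 1 * koszul (fun i => t i.+1)
    (fun v => z (false :: v)) v + t 0%N * z (true :: v))) => [|v]; last by ring.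
by rewrite koszul_linear IH; ring.
Qed.

(** The homotopy identity by which every combination of the [t i] annihilates Koszul homology. *)
Lemma koszul_homotopy t c z w :
  koszul t (koszul_wedge c z) w + koszul_wedge c (koszul t z) w =
  (\sum_(i < size w) c i * t i) * z w.
Proof.
have dot_recl k t' c' : \sum_(i < k.+1) c' i * t' i =
    c' 0%N * t' 0%N + \sum_(i < k) c' i.+1 * t' i.+1 :> S by rewrite big_ord_recl.
elim: w t c z => [|[] w IH] t c z /=; first by rewrite big_ord0 mul0r addr0.
  rewrite (@eq_koszul _ _ (fun v => c 0%N * z (false :: v) +
    (-1) * koszul_wedge (fun i => c i.+1) (fun v => z (true :: v)) v)) => [|v]; last by ring.
  rewrite (@eq_koszul_wedge _ _ (fun v => (-1) * koszul (fun i => t i.+1)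
    (fun v => z (true :: v)) v + 0 * z v)) => [|v]; last by ring.
  rewrite koszul_linear koszul_wedge_linear dot_recl mulrDl.
  by rewrite -(IH (fun i => t i.+1) (fun i => c i.+1) (fun v => z (true :: v))); ring.
rewrite [X in _ + X](@eq_koszul_wedge _ _ (fun v => 1 * koszul (fun i => t i.+1)
    (fun v => z (false :: v)) v + t 0%N * z (true :: v))) => [|v]; last by ring.
rewrite koszul_wedge_linear dot_recl mulrDl.
by rewrite -(IH (fun i => t i.+1) (fun i => c i.+1) (fun v => z (false :: v))); ring.
Qed.

Lemma koszul_mem J t z w : is_ideal J ->
  (forall v, size v = size w -> J (z v)) -> J (koszul t z w).
Proof.
move=> idJ; elim: w t z => [|b w IH] t z Jz /=; first exact: ideal0.
have Jd : J (koszul (fun i => t i.+1) (fun v => z (b :: v)) w).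
  by apply: IH => v sv; apply: Jz; rewrite /= sv.
case: b Jz Jd => Jz Jd; first exact: ideal_opp.
by apply: ideal_addr => //; apply: ideal_mull => //; apply: Jz.
Qed.

Lemma koszul_wedge_mem J c z w : is_ideal J ->
  (forall v, size v = size w -> J (z v)) -> J (koszul_wedge c z w).
Proof.
move=> idJ; elim: w c z => [|b w IH] c z Jz /=; first exact: ideal0.
have Jd : J (koszul_wedge (fun i => c i.+1) (fun v => z (b :: v)) w).
  by apply: IH => v sv; apply: Jz; rewrite /= sv.
case: b Jz Jd => Jz Jd //.
by apply: ideal_sub => //; apply: ideal_mull => //; apply: Jz.
Qed.

Lemma koszul_boundary_mem Q t z w : is_ideal Q ->
  (forall i, (i < size w)%N -> Q (t i)) -> Q (koszul t z w).
Proof.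
move=> idQ; elim: w t z => [|b w IH] t z Qt /=; first exact: ideal0.
have Qd : Q (koszul (fun i => t i.+1) (fun v => z (b :: v)) w).
  by apply: IH => i iw; apply: Qt.
case: b Qt Qd => Qt Qd; first exact: ideal_opp.
by apply: ideal_addr => //; apply: ideal_mulr => //; apply: Qt.
Qed.

Definition koszul_deg (d : nat) z := forall v, count id v != d -> z v = 0.

Lemma koszul_wedge_deg d c z : koszul_deg d z -> koszul_deg d.+1 (koszul_wedge c z).
Proof.
move=> degz w; rewrite /koszul_deg in degz.
have : forall v, (0 + count id v != d)%N -> z v = 0 by [].
rewrite -[count id w]add0n; move: {degz} 0%N => j.
elim: w j c z => [|[] w IH] j c z //= degz H.
  rewrite degz; last by rewrite /= add0n; move: H; rewrite add1n addnS eqSS.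
  rewrite (IH j.+1) ?mulr0 ?subrr // => [v Hv|]; last by rewrite addSnnS.
  by apply: degz; rewrite /= add1n addnS.
by apply: (IH j) => // v Hv; apply: degz.
Qed.

Definition koszul_exact (k : nat) t J (d : nat) := forall z, koszul_deg d z ->
  (forall v, size v = k -> J (koszul t z v)) ->
  exists y, forall v, size v = k -> J (z v - koszul t y v).

Lemma word_choice (k : nat) (R : seq bool -> S -> Prop) :
  (forall v, size v = k -> exists h, R v h) ->
  exists y, forall v, size v = k -> R v (y v).
Proof.
move=> HR; have [y Hy] := fin_all_exists (fun v : k.-tuple bool => HR v (size_tuple v)).
exists (fun v => oapp y 0 (insub v)) => v sv.
by rewrite insubT ?sv // => sv'; apply: (Hy (Tuple sv')).
Qed.

(* Since f annihilates the Koszul homology of S/J, the long exact sequence of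
   0 -> S/J -> S/J -> S/(J, f) -> 0 shifts vanishing down by one degree. *)
Lemma koszul_exact_step k t J d f : is_ideal J -> (forall g, J (f * g) -> J g) ->
  (exists c, J (f - \sum_(i < k) c i * t i)) ->
  koszul_exact k t (ideal_add1 J f) d.+1 -> koszul_exact k t J d.
Proof.
move=> idJ regf [c Jf] ex z degz Jz.
have idJf := ideal_add1_ideal f idJ.
(* Modulo [J] the boundary of [w0] is [f * z]. By exactness modulo [(J, f)], [w0] is a boundary plus
   [f * y]; taking boundaries and cancelling [f] shows that [y] bounds [z]. *)
pose w0 := koszul_wedge c z; pose dot := \sum_(i < k) c i * t i.
have dw0 v : size v = k -> koszul t w0 v = dot * z v - koszul_wedge c (koszul t z) v.
  by move=> sv; rewrite /dot -sv -koszul_homotopy addrK.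
have Jhz v : size v = k -> J (koszul_wedge c (koszul t z) v).
  by move=> sv; apply: koszul_wedge_mem => // u su; apply: Jz; rewrite su.
have [||v1 Hv1] := ex w0.
- exact: koszul_wedge_deg.
- move=> v sv; exists (z v); rewrite dw0 //.
  rewrite (_ : _ - _ = - (koszul_wedge c (koszul t z) v + (f - dot) * z v)); last by ring.
  apply: ideal_opp => //; apply: ideal_addr => //; first exact: Jhz.
  exact: ideal_mulr.
have [y Hy] := word_choice Hv1; exists y => v sv; apply: regf.
have : J (koszul t (fun u => 1 * (1 * w0 u + (-1) * koszul t v1 u) + (- f) * y u) v).
  apply: koszul_mem => // u su; have := Hy u; rewrite su => /(_ sv).
  by rewrite (_ : 1 * _ + _ = w0 u - koszul t v1 u - y u * f) //; ring.
rewrite !koszul_linear koszul_koszul dw0 // => H.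
rewrite (_ : f * _ = (1 * (1 * (dot * z v - koszul_wedge c (koszul t z) v) + -1 * 0) +
  - f * koszul t y v) + ((f - dot) * z v + koszul_wedge c (koszul t z) v)); last by ring.
apply: ideal_addr => //; apply: ideal_addr => //; last exact: Jhz.
exact: ideal_mulr.
Qed.

(** Above degree [k] there are no chains; each regular element in the ideal of [J] and the [t i]
    brings exactness one degree further down. *)
Lemma wreg_koszul_exact k t J d fs : is_ideal J -> wreg J fs ->
  (forall f, f \in fs -> exists c, J (f - \sum_(i < k) c i * t i)) ->
  (k < d + size fs)%N -> koszul_exact k t J d.
Proof.
elim: fs J d => [|f fs IH] J d idJ /=.
  move=> _ _; rewrite addn0 => kd z degz Jz; exists z => v sv.
  rewrite degz ?sub0r; last first.
    by rewrite neq_ltn (leq_ltn_trans (count_size id v)) // sv.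
  by apply: ideal_opp => //; apply: Jz.
move=> [regf wf] Hc kd; apply: (@koszul_exact_step _ _ _ _ f) => //.
  by apply: Hc; rewrite mem_head.
apply: IH => //; first exact: ideal_add1_ideal.
  move=> g gfs; have [|c Jc] := Hc g; first by rewrite inE gfs orbT.
  by exists c; apply: ideal_add1_sub.
by rewrite addSnnS.
Qed.

Fixpoint koszul_lin c (w : seq bool) : S :=
  if w is b :: w' then
    if b then (if has id w' then 0 else c 0%N) else koszul_lin (fun i => c i.+1) w'
  else 0.

Lemma koszul_lin_deg c : koszul_deg 1 (koszul_lin c).
Proof.
move=> w; elim: w c => [|[] w IH] c //=; last exact: IH.
by rewrite has_count; case: (count id w).
Qed.

Lemma koszul_koszul_lin t c w : koszul t (koszul_lin c) w =
  if has id w then 0 else \sum_(i < size w) c i * t i.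
Proof.
have koszul0 t' z w' : (forall v, z v = 0) -> koszul t' z w' = 0.
  elim: w' t' z => //= b w' IHw t' z z0.
  by case: b; rewrite IHw // ?oppr0 // z0 mulr0 addr0.
have koszul_deg0 t' a w' : koszul t' (fun v => if has id v then 0 else a) w' = 0.
  elim: w' t' => [|[] w' IHw] t' //=; last by rewrite IHw mulr0 addr0.
  by rewrite koszul0 ?oppr0.
elim: w t c => [|[] w IH] t c /=; first by rewrite big_ord0.
  by rewrite koszul_deg0 oppr0.
rewrite IH big_ord_recl; case: ifP => _; first by rewrite mulr0 addr0.
by rewrite addrC mulrC.
Qed.

Lemma koszul_lin_coef c k i : (i < k)%N ->
  exists2 w, size w = k & koszul_lin c w = c i.
Proof.
elim: k i c => // k IH [|i] c ik.
  exists (true :: nseq k false); rewrite /= ?size_nseq //.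
  by rewrite has_nseq andbF.
by have [w sw E] := IH i (fun i => c i.+1) ik; exists (false :: w); rewrite //= sw.
Qed.

(** The syzygy is a cycle of degree one, hence a boundary modulo [J], and boundaries have
    coefficients in the ideal of the [t i]. *)
Lemma koszul_exact_syzygy k t J Q c : is_ideal J -> is_ideal Q ->
  (forall f, J f -> Q f) -> (forall i, (i < k)%N -> Q (t i)) ->
  koszul_exact k t J 1 -> J (\sum_(i < k) c i * t i) ->
  forall i, (i < k)%N -> Q (c i).
Proof.
move=> idJ idQ JQ Qt ex Jc i ik; have [|v sv|y Hy] := ex (koszul_lin c).
- exact: koszul_lin_deg.
- by rewrite koszul_koszul_lin sv; case: ifP => _ //; apply: ideal0.
have [w sw <-] := koszul_lin_coef c ik; rewrite -(subrK (koszul t y w) (koszul_lin c w)).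
apply: ideal_addr => //; first exact/JQ/Hy.
by apply: koszul_boundary_mem => //; rewrite sw.
Qed.

Lemma max_ideal_radical Q f : is_ideal Q -> (forall i, Q ('X_i ^+ 2)) ->
  max_ideal f -> exists k, Q (f ^+ k.+1).
Proof.
move=> idQ QX; apply: (@ideal_span_min _ _ _ (fun f => exists k, Q (f ^+ k.+1))).
  split; first by exists 0%N; rewrite expr1; apply: ideal0.
  split=> [g h [a Qa] [b Qb]|g h [a Qa]]; last first.
    by exists a; rewrite exprMn; apply: ideal_mull.
  exists (a + b).+1; rewrite exprDn; apply: ideal_sum => // i _.
  rewrite -mulr_natr; apply: ideal_mulr => //.
  have [lea|ltb] := leqP a.+1 ((a + b).+2 - i).
    by rewrite -(subnK lea) exprD; apply: ideal_mulr => //; apply: ideal_mull.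
  have leb : (b.+1 <= i)%N by lia.
  by rewrite -(subnK leb) exprD; do 2!apply: ideal_mull => //.
by move=> _ [i ->]; exists 1%N; apply: QX.
Qed.

End Koszul.

(** * Cohen-Macaulayness excludes duplicated vertices *)

Section CohenMacaulay.

Variables (K : fieldType) (s : nat) (e : rel 'I_s).
Hypotheses (esym : ssrbool.symmetric e) (eirr : irreflexive e).
Variable m : 'I_s -> 'I_s.
Hypotheses (mK : involutive m) (em : forall v, e v (m v)).
Hypothesis msplit : splits_min_covers e m.
Local Notation S := {mpoly K[s]}.
Local Open Scope ring_scope.

(** Send ['X_(m v)] to [- 'X_v], fix ['X_v] and kill the other variables: pair sums vanish and edge
    products land in degree two. [Q] is the preimage of the polynomials without terms of degree
    below two. *)
Lemma pair_sum_separation v :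
  exists2 Q : S -> Prop, is_ideal Q & [/\ forall p, edge_ideal K e p -> Q p,
    forall y, Q (pair_sum K m y) &
    forall a, a != v -> a != m v -> ~ Q ('X_v - 'X_a) /\ ~ Q 'X_v].
Proof.
pose lq : s.-tuple S :=
  [tuple if i == v then 'X_v else if i == m v then - 'X_v else 0 | i < s].
pose deg2 := @mon_ideal K s (fun u => 1 < mdeg u)%N.
have id2 : is_ideal deg2.
  by apply: mon_ideal_ideal => u w h; rewrite mdegD ltn_addr.
have lqX a : 'X_a \mPo lq = if a == v then 'X_v else if a == m v then - 'X_v else 0.
  by rewrite comp_mpolyXU -tnth_nth tnth_mktuple.
have nev : v != m v by apply: contraTneq (em v) => <-; rewrite eirr.
have n2 : ~ deg2 'X_v by move/mon_idealX; rewrite mdeg1.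
have idQ : is_ideal (fun p => deg2 (p \mPo lq)).
  split; first by rewrite comp_mpoly0; apply: (ideal0 id2).
  split=> p q; first by rewrite comp_mpolyD; apply: (ideal_addr id2).
  by rewrite rmorphM; apply: (ideal_mull _ id2).
exists (fun p => deg2 (p \mPo lq)); first exact: idQ.
split.
- apply: (ideal_span_min idQ).
  have sc a : exists x : K, 'X_a \mPo lq = x *: 'X_v.
    rewrite lqX; case: ifP => _; first by exists 1; rewrite scale1r.
    by case: ifP => _; [exists (-1); rewrite scaleN1r|exists 0; rewrite scale0r].
  move=> _ [a [b [_ ->]]]; rewrite rmorphM /=.
  have [x ->] := sc a; have [x' ->] := sc b.
  rewrite -scalerAl -scalerAr -mpolyXD; do 2!apply: (ideal_scale _ id2).
  by apply/mon_idealX; rewrite mdegD !mdeg1.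
- move=> y; rewrite comp_mpolyD !lqX (inj_eq (inv_inj mK)) (inv_eq mK).
  have [->|yv] := eqVneq y v; first by rewrite (negPf nev) subrr; apply: (ideal0 id2).
  by case: ifP => _; rewrite ?addr0 ?addNr; apply: (ideal0 id2).
- move=> a av amv; rewrite comp_mpolyB !lqX eqxx (negPf av) (negPf amv) subr0.
  by split.
Qed.

Lemma no_duplicated_of_cohen_macaulay :
  cohen_macaulay (edge_ideal K e) -> no_duplicated_vertices e.
Proof.
move=> [d [[[fs [szf reg]] _] [_ maxd]]] t t' dup.
have [tt' h h'] := (duplicated_pairing esym eirr em msplit t t').1 dup.
have [C mC _] := min_vertex_cover_avoiding1 eirr t.
(* Dimension at least [#|~: C|] forces the regular sequence [fs] to have at least that many
   elements. *)
have led : (#|~: C| <= d)%N.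
  exact/maxd/cover_prime_chain/min_vertex_cover_cover.
pose I := edge_ideal K e; have idI : is_ideal I := ideal_span_ideal _.
(* Each pair has exactly one vertex outside [C], so the [th i] with [i < k] list every pair sum
   once. *)
pose k := #|~: C|; pose th i : S := pair_sum K m (nth t (enum (~: C)) i).
have rep v : exists2 i, (i < k)%N & th i = 'X_v + 'X_(m v).
  have H x : x \in ~: C -> exists2 i, (i < k)%N & th i = pair_sum K m x.
    move=> xC; exists (index x (enum (~: C))); last by rewrite /th nth_index ?mem_enum.
    by rewrite /k cardE index_mem mem_enum.
  case vC: (v \in C); last by apply: H; rewrite inE vC.
  have [|i ik E] := H (m v); first by rewrite inE msplit // vC.
  by exists i; rewrite // E /pair_sum mK addrC.
(* The ideal generated by [I] and the pair sums; [RX2] puts the maximal ideal into its radical, so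
   powers of [fs] lie in it. *)
pose R f := exists c : nat -> S, I (f - \sum_(i < k) c i * th i).
have IR f : I f -> R f.
  move=> If; exists (fun _ => 0); rewrite big1 ?subr0 // => i _; exact: mul0r.
have idR : is_ideal R.
  split; first by apply: IR; apply: ideal0.
  split=> [f g [c Hc] [c' Hc']|f g [c Hc]].
    exists (fun i => c i + c' i); under eq_bigr do rewrite mulrDl.
    by rewrite big_split /= opprD addrACA; apply: ideal_addr.
  exists (fun i => f * c i); under eq_bigr do rewrite -mulrA.
  by rewrite -big_distrr -mulrBr; apply: ideal_mull.
have sum_delta a i : (i < k)%N ->
    \sum_(j < k) (if j == i :> nat then a else 0) * th j = a * th i.
  move=> ik; rewrite (bigD1 (Ordinal ik)) //= eqxx big1 ?addr0 // => j.
  by rewrite -val_eqE /= => /negPf->; rewrite mul0r.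
have Rth i : (i < k)%N -> R (th i).
  move=> ik; exists (fun j => if j == i then 1 else 0).
  by rewrite sum_delta // mul1r subrr; apply: ideal0.
have edgeI a b : e a b -> I ('X_a * 'X_b).
  by move=> eab; apply: ideal_span_gen; exists a, b.
have RX2 v : R ('X_v ^+ 2).
  have [i ik E] := rep v; rewrite (_ : _ ^+ 2 = 'X_v * th i - 'X_v * 'X_(m v)).
    apply: ideal_sub => //; first by apply: ideal_mull => //; apply: Rth.
    exact/IR/edgeI.
  by rewrite E; ring.
have wI : wreg I fs by apply/wregP => // i il g; apply: (reg.1 i il).2.
have [f ff|fs' [szf' wI' HR]] := wreg_powers (Q := R) idI wI.
  apply: max_ideal_radical => //; have := reg.1 (index f fs).
  by rewrite index_mem ff nth_index // => /(_ isT)[].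
have ex : koszul_exact k th I 1.
  by apply: wreg_koszul_exact wI' HR _; rewrite // szf' szf add1n ltnS.
have [i1 i1k E1] := rep t; have [i2 i2k E2] := rep t'.
(* A difference of two terms, so that no case distinction on [i1 = i2] is needed for the syzygy; the
   entry at [i1] is ['X_t'] or ['X_t' - 'X_t], and [Q] contains neither. *)
pose c i : S := (if i == i1 then 'X_t' else 0) - (if i == i2 then 'X_t else 0).
have Ic : I (\sum_(i < k) c i * th i).
  under eq_bigr do rewrite mulrBl.
  rewrite sumrB !sum_delta // E1 E2.
  rewrite (_ : _ - _ = 'X_(m t) * 'X_t' - 'X_(m t') * 'X_t); last by ring.
  by apply: ideal_sub => //; apply: edgeI.
have [Q idQ [IQ thQ nQ]] := pair_sum_separation t'.
have tmt' : t != m t' by apply: contraTneq h' => ->; rewrite eirr.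
have := koszul_exact_syzygy idI idQ IQ (fun i _ => thQ _) ex Ic i1k.
rewrite /c eqxx; case: ifP => _; rewrite ?subr0; apply nQ with (a := t) => //.
Qed.

End CohenMacaulay.

(** * Linear syzygies of the cover ideal *)

Section LinearPresentation.

Variables (K : fieldType) (s : nat) (e : rel 'I_s).
Hypotheses (esym : ssrbool.symmetric e) (eirr : irreflexive e).
Variable m : 'I_s -> 'I_s.
Hypotheses (mK : involutive m) (em : forall v, e v (m v)).
Hypothesis msplit : splits_min_covers e m.
Local Notation S := {mpoly K[s]}.
Local Notation mincover := (mincover_type e).
Implicit Types (C D E : mincover) (a b : mincover -> S) (w : 'X_{1..s}).
Local Open Scope ring_scope.

Definition cover_mnm (A : {set 'I_s}) : 'X_{1..s} := [multinom (i \in A : nat) | i < s].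

Lemma cover_monomialE (A : {set 'I_s}) : cover_monomial K A = 'X_[cover_mnm A].
Proof.
rewrite /cover_monomial mpolyXE_id [LHS]big_mkcond; apply: eq_bigr => i _.
by rewrite mnmE; case: (i \in A); rewrite ?expr1 ?expr0.
Qed.

Lemma cover_mnm_leP (A : {set 'I_s}) w :
  reflect (forall i, i \in A -> (0 < w i)%N) (cover_mnm A <= w)%MM.
Proof.
apply: (iffP mnm_lepP) => H i; first by move=> iA; have := H i; rewrite mnmE iA.
by rewrite mnmE; case iA: (i \in A) => //; apply: H.
Qed.

Lemma card_mincover C D : #|val C| = #|val D|.
Proof.
apply: double_inj.
by rewrite !(double_card_min_vertex_cover mK msplit) //; [apply: (valP D)|apply: (valP C)].
Qed.

Local Notation u C := (cover_monomial K (val C)).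

Lemma sum_pair C D (x y : S) : C != D ->
  \sum_E (if E == C then x else if E == D then y else 0) * u E = x * u C + y * u D.
Proof.
move=> neCD; rewrite (bigD1 C) //= eqxx (bigD1 D) ?(eq_sym D) //=.
rewrite (negPf neCD) eqxx big1 ?addr0 // => E /andP[/negPf-> /negPf->].
by rewrite mul0r.
Qed.

Lemma msupp_sum_mem (P : pred mincover) (F : mincover -> S) w :
  w \in msupp (\sum_(E | P E) F E) -> exists2 E, P E & w \in msupp (F E).
Proof.
rewrite mcoeff_msupp raddf_sum /= => nz.
have [E /andP[PE wE]|none] := pickP [pred E | P E && (w \in msupp (F E))]; first by exists E.
case/eqP: nz; apply: big1 => E PE; apply/eqP.
by rewrite mcoeff_eq0; have := none E; rewrite /= PE => /negbT.
Qed.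

(* Two covers whose monomials divide a common monomial of degree one more are
   adjacent, so linear syzygies decompose along the components. *)
Lemma linear_syzygy_component (P : pred mincover) a :
  (forall C D, P C -> ~~ P D -> ~~ cover_adj C D) ->
  (forall C, a C \is 1.-homog) -> syzygy (fun C => u C) a ->
  \sum_(C | P C) a C * u C = 0.
Proof.
move=> HP lin; rewrite /syzygy (bigID P) /= => syz.
apply/eqP; rewrite -msupp_eq0; apply/eqP.
case E: (msupp _) => [//|w r].
have wP : w \in msupp (\sum_(C | P C) a C * u C) by rewrite E mem_head.
have wN : w \in msupp (\sum_(C | ~~ P C) a C * u C).
  by move/eqP: syz; rewrite addr_eq0 => /eqP syz; move: wP; rewrite syz (perm_mem (msuppN _)).
have split_w F : w \in msupp (a F * u F) -> exists j, w = (cover_mnm (val F) + U_(j))%MM.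
  rewrite cover_monomialE (perm_mem (msuppMX _ _)) => /mapP[x xa ->].
  by have /eqP/mdeg1P[j /eqP->] := dhomogP _ _ _ (lin F) _ xa; exists j.
have [C PC /split_w[j wj]] := msupp_sum_mem wP.
have [D PD /split_w[l wl]] := msupp_sum_mem wN.
have sub : val C :|: val D \subset j |: val C.
  rewrite subUset subsetUr; apply/subsetP => i iD.
  have : (0 < w i)%N by rewrite wl mnmDE mnmE iD.
  rewrite wj mnmDE mnmE mnm1E !inE eq_sym; case: (i \in val C); first by rewrite orbT.
  by case: (i == j).
case/negP: (HP _ _ PC PD); apply/andP; split.
  by apply: contraNneq PD => <-.
rewrite eqn_leq; apply/andP; split.
  by apply: leq_trans (subset_leq_card sub) _; rewrite cardsU1; case: (_ \in _).
rewrite ltnNge; apply: contra PD => le.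
have /eqP ECD : val C == val C :|: val D by rewrite eqEcard subsetUl.
have /eqP ED : val D == val C.
  by rewrite eqEcard (card_mincover C D) leqnn andbT ECD subsetUr.
by rewrite (val_inj ED).
Qed.

(** For [C] and [D] in different components take the syzygy with entries [u D] at [C] and [- u C] at
    [D]. Linear syzygies restrict to syzygies on the component of [C], but there the product
    [u D * u C] remains. *)
Lemma connected_of_linearly_presented : Ic_linearly_presented K e -> GIc_connected e.
Proof.
move=> [_ pres] C D; apply/negPn/negP => nCD.
have neCD : C != D by apply: contraNneq nCD => ->; apply: connect0.
pose a E := if E == C then u D else if E == D then - u C else 0.
have [|k [v [c [lin Ea]]]] := pres a.
  by rewrite /syzygy sum_pair // mulNr mulrC subrr.
pose P := connect (@cover_adj _ e) C.
have HP E F : P E -> ~~ P F -> ~~ cover_adj E F.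
  by move=> PE; apply: contra => EF; apply: connect_trans PE (connect1 EF).
have : \sum_(E | P E) a E * u E = 0.
  under eq_bigr do rewrite Ea mulr_suml.
  rewrite exchange_big big1 // => i _; have [syz hom] := lin i.
  under eq_bigr do rewrite -mulrA.
  by rewrite -big_distrr /= (linear_syzygy_component HP) ?mulr0.
have aC : a C = u D by rewrite /a eqxx.
rewrite (bigD1 C) /=; last exact: connect0.
rewrite aC big1 ?addr0.
  by move/eqP; rewrite !cover_monomialE -mpolyXD -msize_poly_eq0 msizeX.
move=> E /andP[PE nEC]; rewrite /a (negPf nEC).
case: eqP => [EE|_]; last by rewrite mul0r.
by case/negP: nCD; rewrite -EE.
Qed.

Definition lin_generated a := exists k (v : 'I_k -> mincover -> S) (c : 'I_k -> S),
  (forall i, syzygy (fun C => u C) (v i) /\ forall C, v i C \is 1.-homog) /\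
  forall C, a C = \sum_(i < k) c i * v i C.

Lemma lin_generated_ext a b : a =1 b -> lin_generated a -> lin_generated b.
Proof. by move=> E [k [v [c [H Ha]]]]; exists k, v, c; split=> // C; rewrite -E. Qed.

Lemma lin_generated_add a b :
  lin_generated a -> lin_generated b -> lin_generated (fun C => a C + b C).
Proof.
move=> [p [g [c [Hg Ha]]]] [q [g' [c' [Hg' Hb]]]].
exists (p + q)%N, (fun k => match split k with inl i => g i | inr i => g' i end),
  (fun k => match split k with inl i => c i | inr i => c' i end); split.
  by move=> k; case: split.
move=> C; rewrite Ha Hb big_split_ord /=; congr (_ + _); apply: eq_bigr => i _.
  by rewrite (unsplitK (inl i)).
by rewrite (unsplitK (inr i)).
Qed.

Lemma lin_generated0 : lin_generated (fun _ => 0).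
Proof.
by exists 0%N, (fun _ _ => 0), (fun _ => 0); split=> [[]//|C]; rewrite big_ord0.
Qed.

Lemma lin_generatedZ (x : K) a : lin_generated a -> lin_generated (fun C => x *: a C).
Proof.
move=> [k [v [c [H Ha]]]]; exists k, v, (fun i => x *: c i); split=> // C.
by rewrite Ha scaler_sumr; apply: eq_bigr => i _; rewrite scalerAl.
Qed.

Lemma lin_generated_sum (T : Type) (r : seq T) (F : T -> mincover -> S) :
  (forall i, lin_generated (F i)) -> lin_generated (fun C => \sum_(i <- r) F i C).
Proof.
move=> HF; elim: r => [|i r IH].
  by apply: lin_generated_ext lin_generated0 => C; rewrite big_nil.
by apply: lin_generated_ext (lin_generated_add (HF i) IH) => C; rewrite big_cons.
Qed.

(** The multiple of the unit vector of [C] in multidegree [w]; the subtraction of exponents is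
    truncated, so it is meant for [w] divisible by the monomial of [C]. *)
Definition mon_unit w C : mincover -> S :=
  fun E => if E == C then 'X_[w - cover_mnm (val C)] else 0.

Hypothesis nodup : no_duplicated_vertices e.

(* The path of covers from C to D constructed by [min_cover_exchange] stays
   inside C u D, hence all its monomials divide w. *)
Lemma lin_generated_path w C D :
  (cover_mnm (val C) <= w)%MM -> (cover_mnm (val D) <= w)%MM ->
  lin_generated (fun E => mon_unit w C E - mon_unit w D E).
Proof.
move=> + Dw; have [k] := ubnP #|val D :\: val C|; elim: k C => // k IH C.
rewrite ltnS => cardk Cw; have [->|neCD] := eqVneq C D.
  by apply: lin_generated_ext lin_generated0 => E; rewrite subrr.
have ne : val C != val D by rewrite val_eqE.
have [y [yD yC myC myD mC']] :=
  min_cover_exchange esym eirr mK em msplit nodup (valP C) (valP D) ne.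
have nemy : m y != y by apply: contraNneq yC => <-.
pose C' : mincover := Sub _ mC'.
have wy : (0 < w y)%N by apply: (cover_mnm_leP _ _ Dw).
have C'w : (cover_mnm (val C') <= w)%MM.
  apply/cover_mnm_leP => i; rewrite /= !inE => /predU1P[->//|/andP[_]].
  exact: (cover_mnm_leP _ _ Cw).
have neCC' : C != C' by apply: contraNneq yC => ->; rewrite /= !inE eqxx.
(* One exchange is the linear syzygy with entries ['X_y] at [C] and [- 'X_(m y)] at [C'], multiplied
   up to multidegree [w]. *)
have key : lin_generated (fun E => mon_unit w C E - mon_unit w C' E).
  exists 1%N, (fun _ E => if E == C then 'X_y else if E == C' then - 'X_(m y) else 0),
    (fun _ => 'X_[w - cover_mnm (y |: val C)]); split=> [_|E].
    split=> [|E]; last first.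
      case: ifP => _; first by rewrite dhomogX /= mdeg1.
      case: ifP => _; last exact: dhomog0.
      by rewrite dhomogN dhomogX /= mdeg1.
    rewrite /syzygy sum_pair // mulNr !cover_monomialE -!mpolyXD.
    apply/eqP; rewrite subr_eq0; apply/eqP; congr 'X_[_]; apply/mnmP => i.
    rewrite !mnmDE !mnm1E !mnmE /= !inE.
    have [<-|yi] := eqVneq y i; first by rewrite (negPf yC) (negPf nemy) ?eqxx.
    by rewrite (eq_sym i) /=; have [<-|] := eqVneq (m y) i; rewrite ?myC.
  rewrite big_ord1 /mon_unit; have [->|nEC] := eqVneq E C.
    rewrite (negPf neCC') subr0 -mpolyXD; congr 'X_[_]; apply/mnmP => i.
    rewrite mnmDE !mnmBE !mnmE !inE (eq_sym i).
    have [<-|yi] := eqVneq y i; last by rewrite addn0.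
    by rewrite (negPf yC) subn0 subnK.
  case: eqP => _; last by rewrite subr0 mulr0.
  rewrite sub0r mulrN -mpolyXD; congr (- 'X_[_]); apply/mnmP => i.
  rewrite mnmDE !mnmBE !mnmE /= !inE (eq_sym i).
  have [<-|yi] := eqVneq y i; first by rewrite (negPf nemy) addn0.
  rewrite /= (eq_sym i); have [<-|myi] := eqVneq (m y) i; last by rewrite addn0.
  by rewrite myC subn0 subnK // (cover_mnm_leP _ _ Cw).
have {}IH : lin_generated (fun E => mon_unit w C' E - mon_unit w D E).
  apply: IH => //; apply: leq_trans cardk; apply: proper_card; apply/properP; split.
    apply/subsetP => v; rewrite /= !inE !negb_or negb_and negbK.
    case/andP=> /andP[vy /orP[/eqP->|->]] vD; last by rewrite vD.
    by rewrite vD in myD.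
  by exists y; rewrite ?inE ?yC ?eqxx.
by apply: lin_generated_ext (lin_generated_add key IH) => E; rewrite addrA subrK.
Qed.

(* Choosing one cover below each monomial w defines a K-linear section of
   S^r -> S modulo linear syzygies. *)
Definition section_mon w : mincover -> S :=
  if [pick C : mincover | (cover_mnm (val C) <= w)%MM] is Some C then mon_unit w C
  else fun _ => 0.

Lemma section_mon_generated w C : (cover_mnm (val C) <= w)%MM ->
  lin_generated (fun E => mon_unit w C E - section_mon w E).
Proof.
move=> Cw; rewrite /section_mon; case: pickP => [D Dw|/(_ C)]; last by rewrite Cw.
exact: lin_generated_path.
Qed.

(** A syzygy is a combination of vectors [mon_unit], and the section of its image is zero.
    Subtracting that section leaves a combination of differences that linear syzygies generate. *)
Lemma linearly_presented_of_no_duplicated : Ic_linearly_presented K e.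
Proof.
split.
  exists s./2 => C; rewrite cover_monomialE dhomogX /= mdegE.
  under eq_bigr do rewrite mnmE.
  rewrite -big_mkcond sum1_card -(doubleK #|val C|).
  by rewrite (double_card_min_vertex_cover mK msplit (valP C)).
move=> a syz; rewrite -/(lin_generated a).
(* Degrees in [a C] are below [B] and those in [a C * u C] below [B + s], so both expansions are
   finite; [sect D p] is the coordinate at [D] of the section of [p]. *)
pose B := (\max_(C : mincover) msize (a C))%N.
have aE C : a C = \sum_(x : 'X_{1..s < B}) (a C)@_x *: 'X_[x].
  by apply: mpolywE; apply: leq_bigmax.
pose sect D p := \sum_(w : 'X_{1..s < B + s}) p@_w *: section_mon w D.
have sectX D C (x : 'X_{1..s < B}) : sect D 'X_[x + cover_mnm (val C)] =
    section_mon (x + cover_mnm (val C))%MM D.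
  have lt : (mdeg (x + cover_mnm (val C)) < B + s)%N.
    rewrite mdegD -addSn leq_add ?bmdeg // mdegE; under eq_bigr do rewrite mnmE.
    by rewrite -big_mkcond sum1_card -[X in (_ <= X)%N](card_ord s) max_card.
  rewrite /sect (bigD1 (BMultinom lt)) //= mcoeffX eqxx scale1r big1 ?addr0 // => w nw.
  rewrite mcoeffX; case: eqP => [E|_]; last by rewrite scale0r.
  by case/eqP: nw; apply: val_inj.
have sect0 D : \sum_C \sum_(x : 'X_{1..s < B}) (a C)@_x *:
    section_mon (x + cover_mnm (val C))%MM D = 0.
  transitivity (sect D (\sum_C a C * u C)); last first.
    by rewrite syz /sect big1 // => w _; rewrite mcoeff0 scale0r.
  rewrite /sect; under [RHS]eq_bigr do rewrite raddf_sum scaler_suml.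
  rewrite [RHS]exchange_big; apply: eq_bigr => C _ /=.
  rewrite {2}(aE C) mulr_suml.
  under [RHS]eq_bigr do rewrite raddf_sum scaler_suml.
  rewrite [RHS]exchange_big; apply: eq_bigr => x _ /=; rewrite -sectX /sect scaler_sumr.
  apply: eq_bigr => w _.
  by rewrite cover_monomialE -scalerAl -mpolyXD mcoeffZ scalerA.
apply: (@lin_generated_ext (fun D => \sum_C \sum_(x : 'X_{1..s < B}) (a C)@_x *:
    (mon_unit (x + cover_mnm (val C))%MM C D - section_mon (x + cover_mnm (val C))%MM D))).
  move=> D; transitivity (\sum_C \sum_(x : 'X_{1..s < B})
      (a C)@_x *: mon_unit (x + cover_mnm (val C))%MM C D - 0).
    rewrite -[X in _ = _ - X](sect0 D) -sumrB; apply: eq_bigr => C _; rewrite -sumrB.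
    by apply: eq_bigr => x _; rewrite scalerBr.
  rewrite subr0 (bigD1 D) //= [X in _ + X]big1 ?addr0 => [|C nCD].
    by rewrite [RHS]aE; apply: eq_bigr => x _; rewrite /mon_unit eqxx addmK.
  by apply: big1 => x _; rewrite /mon_unit eq_sym (negPf nCD) scaler0.
apply: lin_generated_sum => C; apply: lin_generated_sum => x.
apply/lin_generatedZ/section_mon_generated.
by apply/mnm_lepP => i; rewrite mnmDE leq_addl.
Qed.

End LinearPresentation.

Theorem theorem5p8 (K : fieldType) (s : nat) (e : rel 'I_s)
  (hsimple : simple_graph e) (hnoiso : no_isolated_vertices e)
  (hunm : unmixed e) (hkonig : konig e) :
  [<-> cohen_macaulay (edge_ideal K e);
       Ic_linearly_presented K e;
       GIc_connected e;
       no_duplicated_vertices e;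
       induced_4cycles_have_nonP_edge e;
       unique_perfect_matching e].
Proof.
case: hsimple => sym irr.
have [m [mK em] msplit] := konig_splitting_pairing sym irr hnoiso hunm hkonig.
have [C mC _] := @sub_min_vertex_cover s e setT (introT (vertex_coverP e setT)
  (fun x y _ => introT orP (or_introl (in_setT x)))).
(* The implications form a cycle; those from (a) to (b), (e) to (f) and (f) to (a) pass through
   (d). *)
tfae.
- move=> /(no_duplicated_of_cohen_macaulay sym irr mK em msplit).
  exact: (linearly_presented_of_no_duplicated K sym irr mK em msplit).
- exact: (connected_of_linearly_presented mK msplit).
- exact: (no_duplicated_of_connected sym irr mK em msplit).
- exact: nonP_4cycles_of_no_duplicated.
- move=> /(no_duplicated_of_nonP_4cycles sym irr mK em msplit).
  exact: (unique_matching_of_no_duplicated sym irr mK em msplit).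
- move=> /(no_duplicated_of_unique_matching sym irr mK em msplit).
  exact: (cohen_macaulay_of_no_duplicated K sym irr mK em msplit mC).
Qed.
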